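(* Let $a\in\mathcal C[0,1]$ be weakly degenerate with interior degeneracy point $x_0\in(0,1)$, that is, $a(x_0)=0$, $a(x)>0$ for all $x\in[0,1]\setminus\{x_0\}$ and $\frac1a\in L^1(0,1)$. Let $\beta_0,\beta_1>0$ and $\gamma_0,\gamma_1\le 0$ be real numbers. Let $X_\mu$ be the Hilbert space, and $A_1u=(au'')''$ with domain $D_w(A_1)\subseteq X_\mu$ the operator with generalized Wentzell boundary conditions, defined in the context. Then $A_1:D_w(A_1)\to X_\mu$ is non negative (i.e. $\langle A_1u,u\rangle_{X_\mu}\ge 0$ for all $u\in D_w(A_1)$), self-adjoint, and has dense domain in $X_\mu$. Consequently $-A_1$ generates a (strongly continuous) contraction semigroup on $X_\mu$.
   Context: All function spaces are real. Space $X_\mu$: the completion of $\mathcal C[0,1]$ with respect to $\|f\|_{X_\mu}^2=\int_0^1|f|^2dx+\frac{a(0)|f(0)|^2}{\beta_0}+\frac{a(1)|f(1)|^2}{\beta_1}$. It is identified with $L^2(0,1)\times\mathbb R\times\mathbb R$: an element $f\in X_\mu$ is a triple $(f|_{(0,1)},f(0),f(1))$ with $f|_{(0,1)}\in L^2(0,1)$ and $f(0),f(1)\in\mathbb R$ (independent components, called the boundary values of $f$), and the inner product is $\langle f,g\rangle_{X_\mu}=\int_0^1 fg\,dx+\frac{a(0)f(0)g(0)}{\beta_0}+\frac{a(1)f(1)g(1)}{\beta_1}$. A continuous function $u$ on $[0,1]$ is identified with the triple $(u,u(0),u(1))$. Weighted space (weakly degenerate case): $H^2_a(0,1)=\{u\in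 H^1(0,1): u' \text{ is absolutely continuous in }[0,1],\ \sqrt a\,u''\in L^2(0,1)\}$. Operator: $\mathcal Z_\mu(0,1)=\{u\in H^2_a(0,1): au''\in H^2(0,1),\ (au'')''\in X_\mu\}$, and $D_w(A_1)$ is the set of $u\in\mathcal Z_\mu(0,1)$ satisfying $(BC)$: $u''(0)=u''(1)=0$, and $(GWBC)_1$: $A_1u(j)+(-1)^{j+1}\frac{\beta_j}{a(j)}(au'')'(j)+\gamma_ju(j)=0$ for $j=0,1$. Here $A_1u=(au'')''$ is regarded as an element of $X_\mu$ with boundary values $A_1u(0),A_1u(1)$, and $(GWBC)_1$ prescribes these boundary values. Concretely: $D_w(A_1)=\{u\in H^2_a(0,1): au''\in H^2(0,1),\ u''(0)=u''(1)=0\}$ (embedded in $X_\mu$ by $u\mapsto(u,u(0),u(1))$) and $A_1u$ is the triple whose $L^2(0,1)$ component is $(au'')''$ and whose boundary values are $A_1u(j)=(-1)^j\frac{\beta_j}{a(j)}(au'')'(j)-\gamma_ju(j)$, $j=0,1$. *)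

(* Defs.v *)
From HB Require Import structures.
From mathcomp Require Import all_boot all_order all_algebra.
From mathcomp Require Import all_classical all_reals all_analysis.
From mathcomp Require Import measurable_realfun.
From mathcomp Require Import ring lra.

Set Implicit Arguments.
Unset Strict Implicit.
Unset Printing Implicit Defensive.

Import Order.TTheory GRing.Theory Num.Theory.
Import numFieldNormedType.Exports.

Local Open Scope classical_set_scope.
Local Open Scope ring_scope.
Local Open Scope quotient_scope.

(* The library has square-integrable functions (LfunType mu (lee1n 2)) but no
   vector space structure on their classes modulo a.e. equality. *)
Section L2.
Context d (T : measurableType d) (R : realType).
Variable mu : {measure set T -> \bar R}.

Notation L2fun := (LfunType mu (lee1n 2)).

Definition L2_eq (f g : L2fun) := `[< {ae mu, forall x, f x = g x} >].

Let L2_eq_refl : reflexive L2_eq.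
Proof. by move=> f; apply/asboolP; exact: aeW. Qed.

Let L2_eq_sym : symmetric L2_eq.
Proof.
by move=> f g; apply/idP/idP => /asboolP h; apply/asboolP; apply: filterS h.
Qed.

Let L2_eq_trans : transitive L2_eq.
Proof.
move=> g f h /asboolP fg /asboolP gh; apply/asboolP.
by apply: filterS2 fg gh => x -> ->.
Qed.

Canonical L2_eq_equiv := EquivRel L2_eq L2_eq_refl L2_eq_sym L2_eq_trans.

Definition L2 : Type := {eq_quot L2_eq}.
HB.instance Definition _ := Choice.on L2.
HB.instance Definition _ := EqQuotient.on L2.

Definition L2_fun (f : L2) : T -> R := (repr f : L2fun).
Coercion L2_fun : L2 >-> Funclass.

Lemma L2P (f g : L2) : {ae mu, forall x, f x = g x} -> f = g.
Proof.
move=> fg; rewrite -[f]reprK -[g]reprK; apply/eqP.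
by rewrite eqmodE; apply/asboolP.
Qed.

Lemma L2_piE (f : L2fun) : {ae mu, forall x, (\pi_L2 f : L2) x = f x}.
Proof.
have : \pi_L2 (repr (\pi_L2 f)) == \pi_L2 f :> L2 by rewrite reprK.
by rewrite eqmodE => /asboolP.
Qed.

Definition L2_zero : L2 := \pi_L2 (0 : L2fun).
Definition L2_opp (f : L2) : L2 := \pi_L2 (- (repr f : L2fun)).
Definition L2_add (f g : L2) : L2 := \pi_L2 ((repr f : L2fun) + repr g).
Definition L2_scale (c : R) (f : L2) : L2 := \pi_L2 (c *: (repr f : L2fun)).

Lemma L2_add_ae f g : {ae mu, forall x, L2_add f g x = f x + g x}.
Proof. exact: L2_piE. Qed.

Lemma L2_opp_ae f : {ae mu, forall x, L2_opp f x = - f x}.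
Proof. exact: L2_piE. Qed.

Lemma L2_scale_ae c f : {ae mu, forall x, L2_scale c f x = c * f x}.
Proof. exact: L2_piE. Qed.

Lemma L2_zero_ae : {ae mu, forall x, L2_zero x = 0}.
Proof. exact: L2_piE. Qed.

Let L2_addA : associative L2_add.
Proof.
move=> f g h; apply: L2P; near=> x.
rewrite (near (L2_add_ae f (L2_add g h)) x)//.
rewrite (near (L2_add_ae g h) x)//.
rewrite (near (L2_add_ae (L2_add f g) h) x)//.
by rewrite (near (L2_add_ae f g) x)// addrA.
Unshelve. all: by end_near. Qed.

Let L2_addC : commutative L2_add.
Proof.
move=> f g; apply: L2P; near=> x.
rewrite (near (L2_add_ae f g) x)//.
by rewrite (near (L2_add_ae g f) x)// addrC.
Unshelve. all: by end_near. Qed.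

Let L2_add0 : left_id L2_zero L2_add.
Proof.
move=> f; apply: L2P; near=> x.
rewrite (near (L2_add_ae L2_zero f) x)//.
by rewrite (near L2_zero_ae x)// add0r.
Unshelve. all: by end_near. Qed.

Let L2_addN : left_inverse L2_zero L2_opp L2_add.
Proof.
move=> f; apply: L2P; near=> x.
rewrite (near (L2_add_ae (L2_opp f) f) x)//.
rewrite (near (L2_opp_ae f) x)//.
by rewrite (near L2_zero_ae x)// addNr.
Unshelve. all: by end_near. Qed.

HB.instance Definition _ :=
  GRing.isZmodule.Build L2 L2_addA L2_addC L2_add0 L2_addN.

Lemma L2D_ae (f g : L2) : {ae mu, forall x, (f + g : L2) x = f x + g x}.
Proof. exact: L2_add_ae. Qed.

Lemma L2N_ae (f : L2) : {ae mu, forall x, (- f : L2) x = - f x}.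
Proof. exact: L2_opp_ae. Qed.

Lemma L20_ae : {ae mu, forall x, (0 : L2) x = 0}.
Proof. exact: L2_zero_ae. Qed.

Let L2_scaleA a b f : L2_scale a (L2_scale b f) = L2_scale (a * b) f.
Proof.
apply: L2P; near=> x.
rewrite (near (L2_scale_ae a (L2_scale b f)) x)//.
rewrite (near (L2_scale_ae b f) x)//.
by rewrite (near (L2_scale_ae (a * b) f) x)// mulrA.
Unshelve. all: by end_near. Qed.

Let L2_scale1 : left_id 1 L2_scale.
Proof.
move=> f; apply: L2P; near=> x.
by rewrite (near (L2_scale_ae 1 f) x)// mul1r.
Unshelve. all: by end_near. Qed.

Let L2_scaleDr : right_distributive L2_scale +%R.
Proof.
move=> a f g; apply: L2P; near=> x.
rewrite (near (L2_scale_ae a (f + g)) x)//.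
rewrite (near (L2D_ae f g) x)//.
rewrite (near (L2D_ae (L2_scale a f) (L2_scale a g)) x)//.
rewrite (near (L2_scale_ae a f) x)//.
by rewrite (near (L2_scale_ae a g) x)// mulrDr.
Unshelve. all: by end_near. Qed.

Let L2_scaleDl f : {morph L2_scale^~ f : a b / a + b}.
Proof.
move=> a b; apply: L2P; near=> x.
rewrite (near (L2_scale_ae (a + b) f) x)//.
rewrite (near (L2D_ae (L2_scale a f) (L2_scale b f)) x)//.
rewrite (near (L2_scale_ae a f) x)//.
by rewrite (near (L2_scale_ae b f) x)// mulrDl.
Unshelve. all: by end_near. Qed.

HB.instance Definition _ := GRing.Zmodule_isLmodule.Build R L2
  L2_scaleA L2_scale1 L2_scaleDr L2_scaleDl.

Lemma L2Z_ae c (f : L2) : {ae mu, forall x, (c *: f : L2) x = c * f x}.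
Proof. exact: L2_scale_ae. Qed.

Definition L2_dot (f g : L2) : R := \int[mu]_x (f x * g x).

Lemma L2_Lfun (f : L2) : (f : T -> R) \in Lfun mu 2%:R%:E.
Proof. exact: (@LfunP _ _ _ mu _ (lee1n 2)). Qed.

Lemma L2_dot_integrable (f g : L2) :
  mu.-integrable setT (fun x => (f x * g x)%:E).
Proof.
have := Lfun2_mul_Lfun1 (L2_Lfun f) (L2_Lfun g).
by move=> /Lfun1_integrable.
Qed.

Lemma L2_measurable (f : L2) : measurable_fun setT (f : T -> R).
Proof. by have := sub_Lfun_mfun (L2_Lfun f); rewrite inE. Qed.

Lemma L2_dotC f g : L2_dot f g = L2_dot g f.
Proof. by apply: eq_Rintegral => x _; rewrite mulrC. Qed.

Lemma L2_dotDl f g h : L2_dot (f + g) h = L2_dot f h + L2_dot g h.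
Proof.
rewrite /L2_dot -RintegralD//; do ?exact: L2_dot_integrable.
congr fine; apply: ae_eq_integral => //.
- by have /integrableP[] := L2_dot_integrable (f + g) h.
- apply/measurable_EFinP; apply: measurable_funD;
    by apply: measurable_funM; exact: L2_measurable.
- near=> x => _; rewrite /=.
  by rewrite (near (L2D_ae f g) x)// mulrDl.
Unshelve. all: by end_near. Qed.

Lemma L2_dotZl c f g : L2_dot (c *: f) g = c * L2_dot f g.
Proof.
rewrite /L2_dot -RintegralZl//; last exact: L2_dot_integrable.
congr fine; apply: ae_eq_integral => //.
- by have /integrableP[] := L2_dot_integrable (c *: f) g.
- apply/measurable_EFinP; apply: measurable_funM => //.
  by apply: measurable_funM; exact: L2_measurable.
- near=> x => _; rewrite /=.
  by rewrite (near (L2Z_ae c f) x)// mulrA.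
Unshelve. all: by end_near. Qed.

Lemma L2_dot_ge0 f : 0 <= L2_dot f f.
Proof.
apply: Rintegral_ge0 => x _.
by rewrite -expr2 sqr_ge0.
Qed.

Lemma L2_dot_eq0 f : L2_dot f f = 0 -> f = 0.
Proof.
move=> f0; apply: L2P.
have ff := L2_dot_integrable f f.
have : (\int[mu]_x `|(f x * f x)%:E| = 0)%E.
  have -> : (\int[mu]_x `|(f x * f x)%:E| = \int[mu]_x (f x * f x)%:E)%E.
    by apply: eq_integral => x _; rewrite gee0_abs// lee_fin -expr2 sqr_ge0.
  rewrite -[LHS]fineK; first by congr EFin.
  exact: integrable_fin_num.
move=> /ae_eq_integral_abs-/(_ measurableT).
have /integrableP[mff _] := ff.
move=> /(_ mff) h; near=> x.
rewrite (near L20_ae x)//.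
have : ((f x * f x)%:E = 0)%E by apply: (near h x).
by move=> [] /eqP; rewrite mulf_eq0 orbb => /eqP.
Unshelve. all: by end_near. Qed.

End L2.

(* L^2 x R x R with inner product
   <f,g> = int f g + w0 f(0) g(0) + w1 f(1) g(1). *)
Record weighted_L2 d (T : measurableType d) (R : realType)
    (mu : {measure set T -> \bar R}) (w0 w1 : {posnum R}) : Type :=
  WeightedL2 { inner : L2 mu ; bval0 : R ; bval1 : R }.

Section weighted.
Context d (T : measurableType d) (R : realType).
Variable mu : {measure set T -> \bar R}.
Variables w0 w1 : {posnum R}.

Notation wL2 := (weighted_L2 mu w0 w1).

HB.instance Definition _ := gen_eqMixin wL2.
HB.instance Definition _ := gen_choiceMixin wL2.

Lemma weighted_L2P (f g : wL2) :
  inner f = inner g -> bval0 f = bval0 g -> bval1 f = bval1 g -> f = g.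
Proof. by case: f g => [f f0 f1] [g g0 g1] /= -> -> ->. Qed.

Definition wadd (f g : wL2) : wL2 := WeightedL2 w0 w1
  (inner f + inner g) (bval0 f + bval0 g) (bval1 f + bval1 g).
Definition wopp (f : wL2) : wL2 := WeightedL2 w0 w1
  (- inner f) (- bval0 f) (- bval1 f).
Definition wscale (c : R) (f : wL2) : wL2 := WeightedL2 w0 w1
  (c *: inner f) (c * bval0 f) (c * bval1 f).
Definition wzero : wL2 := WeightedL2 w0 w1 0 0 0.

Let waddA : associative wadd.
Proof. by move=> f g h; apply: weighted_L2P; rewrite /= addrA. Qed.

Let waddC : commutative wadd.
Proof. by move=> f g; apply: weighted_L2P; rewrite /= addrC. Qed.

Let wadd0 : left_id wzero wadd.
Proof. by move=> f; apply: weighted_L2P; rewrite /= add0r. Qed.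

Let waddN : left_inverse wzero wopp wadd.
Proof. by move=> f; apply: weighted_L2P; rewrite /= addNr. Qed.

HB.instance Definition _ := GRing.isZmodule.Build wL2 waddA waddC wadd0 waddN.

Let wscaleA a b f : wscale a (wscale b f) = wscale (a * b) f.
Proof. by apply: weighted_L2P; rewrite /= ?scalerA ?mulrA. Qed.

Let wscale1 : left_id 1 wscale.
Proof. by move=> f; apply: weighted_L2P; rewrite /= ?scale1r ?mul1r. Qed.

Let wscaleDr : right_distributive wscale +%R.
Proof. by move=> c f g; apply: weighted_L2P; rewrite /= ?scalerDr ?mulrDr. Qed.

Let wscaleDl f : {morph wscale^~ f : a b / a + b}.
Proof. by move=> a b; apply: weighted_L2P; rewrite /= ?scalerDl ?mulrDl. Qed.

HB.instance Definition _ := GRing.Zmodule_isLmodule.Build R wL2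
  wscaleA wscale1 wscaleDr wscaleDl.

Definition dot (f g : wL2) : R :=
  L2_dot (inner f) (inner g) + w0%:num * (bval0 f * bval0 g)
  + w1%:num * (bval1 f * bval1 g).

Lemma dotC f g : dot f g = dot g f.
Proof. by rewrite /dot L2_dotC (mulrC (bval0 f)) (mulrC (bval1 f)). Qed.

Lemma innerD (f g : wL2) : inner (f + g) = inner f + inner g.
Proof. by []. Qed.

Lemma bval0D (f g : wL2) : bval0 (f + g) = bval0 f + bval0 g.
Proof. by []. Qed.

Lemma bval1D (f g : wL2) : bval1 (f + g) = bval1 f + bval1 g.
Proof. by []. Qed.

Lemma innerZ c (f : wL2) : inner (c *: f) = c *: inner f.
Proof. by []. Qed.

Lemma bval0Z c (f : wL2) : bval0 (c *: f) = c * bval0 f.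
Proof. by []. Qed.

Lemma bval1Z c (f : wL2) : bval1 (c *: f) = c * bval1 f.
Proof. by []. Qed.

Lemma dotDl f g h : dot (f + g) h = dot f h + dot g h.
Proof. by rewrite /dot innerD bval0D bval1D L2_dotDl; ring. Qed.

Lemma dotZl c f g : dot (c *: f) g = c * dot f g.
Proof. by rewrite /dot innerZ bval0Z bval1Z L2_dotZl; ring. Qed.

Lemma dotDr f g h : dot f (g + h) = dot f g + dot f h.
Proof. by rewrite dotC dotDl !(dotC f). Qed.

Lemma dotZr c f g : dot f (c *: g) = c * dot f g.
Proof. by rewrite dotC dotZl dotC. Qed.

Let wsqr_ge0 (w : {posnum R}) (x : R) : 0 <= w%:num * x ^+ 2.
Proof. by rewrite mulr_ge0// sqr_ge0. Qed.

Let wsqr_eq0 (w : {posnum R}) (x : R) : (w%:num * x ^+ 2 == 0) = (x == 0).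
Proof. by rewrite mulf_eq0 sqrf_eq0 gt_eqF. Qed.

Lemma dot_ge0 f : 0 <= dot f f.
Proof.
rewrite /dot -!expr2; apply: addr_ge0 => //.
by apply: addr_ge0 => //; exact: L2_dot_ge0.
Qed.

Lemma dot_eq0 f : dot f f = 0 -> f = 0.
Proof.
rewrite /dot -!expr2 => /eqP.
rewrite paddr_eq0 ?wsqr_ge0 ?addr_ge0 ?L2_dot_ge0//.
rewrite paddr_eq0 ?L2_dot_ge0// !wsqr_eq0 -andbA.
move=> /and3P[/eqP/L2_dot_eq0 + /eqP + /eqP].
by move=> f0 f1 f2; apply: weighted_L2P.
Qed.

Lemma cauchy_schwarz f g : dot f g ^+ 2 <= dot f f * dot g g.
Proof.
have [g0|g0] := eqVneq (dot g g) 0.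
  have -> : g = 0 by exact: dot_eq0.
  have -> : (0 : wL2) = 0 *: (0 : wL2) by rewrite scale0r.
  by rewrite !dotZr !mul0r expr0n mulr0.
have gpos : 0 < dot g g by rewrite lt_def g0 dot_ge0.
have := dot_ge0 (dot g g *: f + (- dot f g) *: g).
rewrite !(dotDl, dotDr, dotZl, dotZr) (dotC g f).
rewrite [leRHS](_ : _ = dot g g * (dot g g * dot f f - dot f g ^+ 2)); last by ring.
by rewrite pmulr_rge0// subr_ge0 mulrC.
Qed.

Definition wL2_norm (f : wL2) : R := Num.sqrt (dot f f).

Let ler_normD f g : wL2_norm (f + g) <= wL2_norm f + wL2_norm g.
Proof.
have nf := sqrtr_ge0 (dot f f); have ng := sqrtr_ge0 (dot g g).
rewrite -(@ler_pXn2r _ 2)// ?nnegrE ?addr_ge0 ?sqrtr_ge0//.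
rewrite sqrrD !sqr_sqrtr ?dot_ge0// dotDl !dotDr (dotC g f).
have : dot f g <= wL2_norm f * wL2_norm g.
  apply: le_trans (ler_norm _) _.
  rewrite -(@ler_pXn2r _ 2)// ?nnegrE ?mulr_ge0//.
  by rewrite real_normK ?num_real// exprMn !sqr_sqrtr ?dot_ge0// cauchy_schwarz.
rewrite -/(wL2_norm f) -/(wL2_norm g); lra.
Qed.

Let normrZ c f : wL2_norm (c *: f) = `|c| * wL2_norm f.
Proof.
by rewrite /wL2_norm dotZl dotZr mulrA -expr2 sqrtrM ?sqr_ge0// sqrtr_sqr.
Qed.

Let normr0_eq0 f : wL2_norm f = 0 -> f = 0.
Proof.
move=> /eqP; rewrite sqrtr_eq0 => f0.
by apply: dot_eq0; apply/eqP; rewrite eq_le f0 dot_ge0.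
Qed.

HB.instance Definition _ :=
  Lmodule_isNormed.Build R wL2 ler_normD normrZ normr0_eq0.

Lemma wL2_normE (f : wL2) : `|f| = Num.sqrt (dot f f).
Proof. by []. Qed.

End weighted.

(* An unbounded operator A : dom A -> V is represented by its graph. *)
Section operators.
Context (R : realType) (V : normedModType R).
Implicit Type A : set (V * V).

Definition dom A : set V := [set x | exists y, A (x, y)].

Definition linear_operator A :=
  [/\ forall x y z, A (x, y) -> A (x, z) -> y = z,
      A (0, 0) &
      forall (c : R) x y x' y', A (x, y) -> A (x', y') ->
        A (c *: x + x', c *: y + y')].

Definition opp_operator A : set (V * V) := [set p | A (p.1, - p.2)].

Variable ip : V -> V -> R.

Definition nonneg_operator A := forall x y, A (x, y) -> 0 <= ip y x.

(* (y, z) is in the adjoint iff <Ax, y> = <x, z> for all x in dom A; this is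
   the graph of a function as soon as dom A is dense. *)
Definition adjoint A : set (V * V) :=
  [set p | forall x w, A (x, w) -> ip w p.1 = ip x p.2].

Definition selfadjoint A := adjoint A = A.

End operators.

Section semigroups.
Context (R : realType) (V : normedModType R).

Record C0_contraction_semigroup (T : R -> V -> V) : Prop := {
  sg_linear : forall t, 0 <= t -> linear (T t) ;
  sg_0 : forall x, T 0 x = x ;
  sg_add : forall s t x, 0 <= s -> 0 <= t -> T (s + t) x = T s (T t x) ;
  sg_cvg0 : forall x, T t x @[t --> 0^'+] --> x ;
  sg_contraction : forall t x, 0 <= t -> `|T t x| <= `|x| }.

Definition generator (T : R -> V -> V) : set (V * V) :=
  [set p | h^-1 *: (T h p.1 - p.1) @[h --> 0^'+] --> p.2].

Definition generates_contraction_semigroup (A : set (V * V)) :=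
  exists T, C0_contraction_semigroup T /\ generator T = A.

End semigroups.

Section sobolev.
Context (R : realType).
Notation mu := (@lebesgue_measure R).
Local Notation I := (`]0%R, 1%R[%classic : set R).

Definition leb01 : {measure set (measurableTypeR R) -> \bar R} :=
  mrestr mu (measurable_itv `]0%R, 1%R[).

Definition square_integrable (f : R -> R) :=
  measurable_fun I f /\ mu.-integrable I (fun x => (f x ^+ 2)%:E).

(* phi in C_c^1(0,1), the test functions used for W^{1,p}(0,1) by Brezis,
   Functional Analysis, Sobolev Spaces and PDE, Section 8.2. *)
Definition test_function (phi : R -> R) :=
  [/\ forall x, derivable phi x 1, continuous (derive1 phi) &
      exists c d, [/\ 0 < c, d < 1 & forall x, x \notin `[c, d] -> phi x = 0]].

Definition weak_derivative (f f' : R -> R) :=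
  [/\ locally_integrable I f, locally_integrable I f' &
      forall phi, test_function phi ->
        \int[mu]_(x in I) (f x * derive1 phi x) =
        - \int[mu]_(x in I) (f' x * phi x)].

(* f is the continuous representative on [0,1] of an element of H^1(0,1),
   and f' represents its derivative. *)
Definition H1 (f f' : R -> R) :=
  [/\ {within `[0, 1], continuous f}, square_integrable f,
      square_integrable f' & weak_derivative f f'].

(* Continuous representatives are chosen for f and f', so that f j and f' j
   are the boundary values at j = 0, 1. *)
Definition H2 (f f' f'' : R -> R) := H1 f f' /\ H1 f' f''.

Definition absolutely_continuous (a b : R) (f : R -> R) :=
  forall e, 0 < e -> exists2 d, 0 < d &
    forall n (s t : 'I_n -> R),
      (forall i, a <= s i /\ s i <= t i /\ t i <= b) ->
      trivIset setT (fun i => `]s i, t i[%classic) ->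
      \sum_(i < n) (t i - s i) < d ->
      \sum_(i < n) `|f (t i) - f (s i)| < e.

Definition H2a (a u u' u'' : R -> R) :=
  [/\ H1 u u', absolutely_continuous 0 1 u', weak_derivative u' u'' &
      square_integrable (fun x => Num.sqrt (a x) * u'' x)].

Record weakly_degenerate (a : R -> R) (x0 : R) : Prop := {
  wd_continuous : {within `[0, 1], continuous a} ;
  wd_interior : 0 < x0 < 1 ;
  wd_zero : a x0 = 0 ;
  wd_pos : forall x, 0 <= x <= 1 -> x != x0 -> 0 < a x ;
  wd_integrable : mu.-integrable I (fun x => (a x)^-1%:E) }.

Lemma wd_pos0 a x0 : weakly_degenerate a x0 -> 0 < a 0.
Proof.
move=> h; have /andP[x00 _] := wd_interior h.
by apply: (wd_pos h); rewrite ?lexx ?ler01// lt_eqF.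
Qed.

Lemma wd_pos1 a x0 : weakly_degenerate a x0 -> 0 < a 1.
Proof.
move=> h; have /andP[_ x01] := wd_interior h.
by apply: (wd_pos h); rewrite ?lexx ?ler01// gt_eqF.
Qed.

End sobolev.

Section wentzell.
Context (R : realType) (a : R -> R) (x0 : R) (ha : weakly_degenerate a x0).
Variables beta0 beta1 : {posnum R}.

Definition Xmu := weighted_L2 (leb01 R)
  (PosNum (divr_gt0 (wd_pos0 ha) (gt0 beta0)))
  (PosNum (divr_gt0 (wd_pos1 ha) (gt0 beta1))).

HB.instance Definition _ := NormedModule.on Xmu.

Definition Xmu_dot : Xmu -> Xmu -> R := @dot _ _ _ _ _ _.

Lemma Xmu_dotE f g : Xmu_dot f g =
  \int[leb01 R]_x (inner f x * inner g x)
  + a 0 / beta0%:num * (bval0 f * bval0 g)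
  + a 1 / beta1%:num * (bval1 f * bval1 g).
Proof. by []. Qed.

Definition represents (f : Xmu) (u : R -> R) (b0 b1 : R) :=
  [/\ {ae leb01 R, forall x, inner f x = u x}, bval0 f = b0 & bval1 f = b1].

Variables gamma0 gamma1 : R.

(* v is the continuous representative of a u''; it need not vanish at x0.
   The values of u'' are pinned down by u'' = v / a wherever a <> 0, in
   particular at the end points. *)
Definition Zmu (u u' u'' v v' v'' : R -> R) :=
  [/\ H2a a u u' u'',
      forall x, 0 <= x <= 1 -> x != x0 -> v x = a x * u'' x &
      H2 v v' v''].

(* (f, g) is in the graph of A_1 iff f comes from u in Z_mu satisfying the
   boundary conditions, and g = (au'')'' in X_mu. *)
Definition A1 : set (Xmu * Xmu) := [set p : Xmu * Xmu |
  exists u u' u'' v v' v'',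
    [/\ Zmu u u' u'' v v' v'',
        represents p.1 u (u 0) (u 1),
        {ae leb01 R, forall x, inner p.2 x = v'' x},
        u'' 0 = 0 /\ u'' 1 = 0 &
        bval0 p.2 - beta0%:num / a 0 * v' 0 + gamma0 * u 0 = 0 /\
        bval1 p.2 + beta1%:num / a 1 * v' 1 + gamma1 * u 1 = 0]].

End wentzell.

Arguments Xmu {R a x0} ha beta0 beta1.
Arguments Xmu_dot {R a x0} ha beta0 beta1 f g : rename.
Arguments A1 {R a x0} ha beta0 beta1 gamma0 gamma1 p : rename.

(* Main.v *)
Require Import Defs.
From mathcomp Require Import all_boot all_order all_algebra.
From mathcomp Require Import all_classical all_reals all_analysis.
From mathcomp Require Import measurable_realfun.
From mathcomp Require Import ring lra.

Set Implicit Arguments.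
Unset Strict Implicit.
Unset Printing Implicit Defensive.

Import Order.TTheory GRing.Theory Num.Theory.
Import numFieldNormedType.Exports.

Local Open Scope classical_set_scope.
Local Open Scope ring_scope.

(* Two integrations by parts turn <A1 u, w> into the symmetric form
   int a u'' w'' - gamma0 (a(0) / beta0) u(0) w(0) - gamma1 (a(1) / beta1) u(1) w(1),
   which is nonnegative for w = u.  For gamma0, gamma1 < 0 the equation A1 u = g
   is solved explicitly: integrate g twice to get v = a u'' with v(0) = v(1) = 0,
   read u(0) and u(1) off the boundary conditions, and integrate v / a twice.  A
   symmetric operator with full range is self-adjoint, and changing gamma0 and
   gamma1 is a bounded symmetric perturbation.  A vector orthogonal to the domain
   is then sent by the adjoint to the image of 0, so it vanishes and the domain is
   dense.  The semigroup generated by -A, for A self-adjoint and nonnegative, is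
   the limit of the Euler scheme T(t) = lim J(t / 2^n)^(2^n) with
   J(t) = (1 + t A)^-1; everything rests on the estimate
   |J(s) J(t) x - J(s + t) x| <= s t |A^2 x|. *)

(** * Hilbert spaces *)

(** In general [u''] is merely integrable near [x0], so regularity is expressed by integral
    identities [f x = f 0 + prim f' x] with [f'] in L^1. Integrability of [1 / a] makes [v / a]
    integrable for every continuous [v], whatever [v x0] is, so solving [A1 u = g] meets no
    compatibility condition at [x0]. In the first integration by parts the boundary terms are
    absorbed by the weights of the inner product; in the second they vanish, because [u''] is 0 at
    the end points and hence so is [v = a u'']. Strictly negative constants are what the boundary
    conditions are divided by to obtain [u 0] and [u 1]. When both constants are 0 the affine
    functions form a kernel and the range is not the whole space; this is the reason for the detour
    through a bounded perturbation. The relation [adjoint] makes sense before density is known, so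
    self-adjointness can come first. *)

Section limits.
Context {R : realType} {V : normedModType R}.

Lemma le_cvg0 {T : Type} {F : set_system T} {FF : Filter F}
    (u : T -> V) (l : V) (b : T -> R) :
  (forall n, `|u n - l| <= b n) -> b @ F --> 0 -> u @ F --> l.
Proof.
move=> ub b0; apply/cvgrPdist_le => e e0; near=> n.
rewrite distrC (le_trans (ub n))//.
near: n; have /cvgrPdist_le/(_ _ e0) := b0.
apply: filterS => n; rewrite sub0r normrN; exact: le_trans (ler_norm _).
Unshelve. all: by end_near. Qed.

Lemma cvg_le_norm (u : V ^nat) (l : V) (c : R) :
  u @ \oo --> l -> (forall n, `|u n| <= c) -> `|l| <= c.
Proof.
move=> ul uc; have nul : `|u n| @[n --> \oo] --> `|l| by exact: cvg_norm.
rewrite -(cvg_lim (@Rhausdorff R) nul).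
apply: limr_le; first by apply/cvg_ex; exists `|l|.
exact: nearW.
Qed.

Lemma cvg_div2X0 (c : R) : (fun n => c / 2 ^+ n) @ \oo --> 0.
Proof.
rewrite -(mulr0 c); apply: cvgMr.
have -> : (fun n => (2 ^+ n)^-1 : R) = (fun n => 2^-1 ^+ n).
  by apply/funext => n; rewrite exprVn.
by apply: cvg_expr; rewrite ger0_norm ?invr_ge0// invf_lt1// ltr1n.
Qed.

Lemma eq_0_of_norm_lt (x : V) : (forall e, 0 < e -> `|x| <= e) -> x = 0.
Proof.
move=> xe; apply/eqP; rewrite -normr_eq0 eq_le normr_ge0 andbT.
by apply/ler_addgt0Pr => e e0; rewrite add0r xe.
Qed.

End limits.

(** The norm of [V] is given beforehand and the inner product has to induce it; completeness, in
    sequential form, is the field that takes work for [Xmu]. *)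
Record hilbert (R : realType) (V : normedModType R) (ip : V -> V -> R) : Prop :=
  { ip_sym : forall x y, ip x y = ip y x ;
    ip_addl : forall x y z, ip (x + y) z = ip x z + ip y z ;
    ip_scalel : forall c x y, ip (c *: x) y = c * ip x y ;
    ip_norm : forall x, ip x x = `|x| ^+ 2 ;
    ip_complete : forall u : V ^nat,
      (forall e, 0 < e -> exists N, forall m n, (N <= m)%N -> (N <= n)%N ->
        `|u m - u n| <= e) ->
      exists l : V, u @ \oo --> l }.

Section hilbert.
Context {R : realType} {V : normedModType R} {ip : V -> V -> R}.
Context (H : hilbert ip).
Implicit Types x y z : V.

Let ipDl := ip_addl H.
Let ipZl := ip_scalel H.
Let ipE := ip_norm H.

Lemma ip_addr x y z : ip x (y + z) = ip x y + ip x z.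
Proof. by rewrite (ip_sym H) ipDl !(ip_sym H x). Qed.

Lemma ip_scaler c x y : ip x (c *: y) = c * ip x y.
Proof. by rewrite (ip_sym H) ipZl (ip_sym H x). Qed.

Lemma ip_oppl x y : ip (- x) y = - ip x y.
Proof. by rewrite -scaleN1r ipZl mulN1r. Qed.

Lemma ip_oppr x y : ip x (- y) = - ip x y.
Proof. by rewrite -scaleN1r ip_scaler mulN1r. Qed.

Lemma ip_subl x y z : ip (x - y) z = ip x z - ip y z.
Proof. by rewrite ipDl ip_oppl. Qed.

Lemma ip_subr x y z : ip x (y - z) = ip x y - ip x z.
Proof. by rewrite ip_addr ip_oppr. Qed.

Lemma ip_0r x : ip x 0 = 0.
Proof. by rewrite -(scale0r 0) ip_scaler mul0r. Qed.

Let ipl := (ipDl, ipZl, ip_addr, ip_scaler, ip_oppl, ip_oppr).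

Lemma normZD2 (c : R) x y :
  `|x + c *: y| ^+ 2 = `|x| ^+ 2 + 2 * c * ip x y + c ^+ 2 * `|y| ^+ 2.
Proof. by rewrite -!ipE !ipl (ip_sym H y x); ring. Qed.

Lemma parallelogram x y :
  `|x + y| ^+ 2 + `|x - y| ^+ 2 = 2 * `|x| ^+ 2 + 2 * `|y| ^+ 2.
Proof. by rewrite -!ipE !ipl; ring. Qed.

Lemma ip_cauchy_schwarz x y : `|ip x y| <= `|x| * `|y|.
Proof.
have [->|y0] := eqVneq y 0; first by rewrite ip_0r !normr0 mulr0.
have ny : 0 < `|y| by rewrite normr_gt0.
(* This coefficient subtracts from [x] its projection on [y]. *)
have h := normZD2 (- (ip x y / `|y| ^+ 2)) x y.
have : 0 <= `|x| ^+ 2 - ip x y ^+ 2 / `|y| ^+ 2.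
  have -> : `|x| ^+ 2 - ip x y ^+ 2 / `|y| ^+ 2
      = `|x + (- (ip x y / `|y| ^+ 2)) *: y| ^+ 2.
    by rewrite h; field; rewrite normr_eq0.
  exact: sqr_ge0.
rewrite subr_ge0 ler_pdivrMr ?exprn_gt0// => h2.
rewrite -(@ler_pXn2r _ 2)// ?nnegrE ?mulr_ge0//.
by rewrite real_normK ?num_real// exprMn.
Qed.

Lemma cvg_ipl {T : Type} {F : set_system T} {FF : Filter F} (u : T -> V) l y :
  u @ F --> l -> ip (u n) y @[n --> F] --> ip l y.
Proof.
move=> ul; apply: (@le_cvg0 _ R^o _ _ _ _ _ (fun n => `|u n - l| * `|y|)) => [n|].
  by rewrite -ip_subl ip_cauchy_schwarz.
rewrite -(mul0r `|y|); apply: cvgMl.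
rewrite -[X in _ --> X](@normr0 _ V) -(subrr l).
by apply: cvg_norm; apply: cvgB => //; exact: cvg_cst.
Qed.

(* A minimizing sequence for the distance from [x] to [W] is Cauchy by the
   parallelogram law; the error at its limit is orthogonal to [W]. *)
Lemma dense_of_trivial_orthogonal (W : set V) :
  W 0 -> (forall c x y, W x -> W y -> W (c *: x + y)) ->
  (forall y, (forall w, W w -> ip w y = 0) -> y = 0) ->
  forall x e, 0 < e -> exists2 w, W w & `|x - w| <= e.
Proof.
move=> W0 WD Worth x.
pose S : set R := [set `|x - w| ^+ 2 | w in W].
have S0 : S !=set0 by exists (`|x - 0| ^+ 2), 0.
have Slb : has_lbound S by exists 0 => _ [w _ <-]; exact: sqr_ge0.
have hS : has_inf S by [].
set d := inf S.
have dle w : W w -> d <= `|x - w| ^+ 2.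
  by move=> Ww; apply: ge_inf => //; exists w.
have /choice[w wP] n : exists w, W w /\ `|x - w| ^+ 2 < d + n.+1%:R^-1.
  have e0 : 0 < n.+1%:R^-1 :> R by rewrite invr_gt0.
  have [_ [w Ww <-] wd] := inf_adherent e0 hS.
  by exists w.
have wW n : W (w n) by have [] := wP n.
have w2 m n : `|w m - w n| ^+ 2 <= 2 * m.+1%:R^-1 + 2 * n.+1%:R^-1.
  have := parallelogram (x - w m) (x - w n).
  (* The midpoint of [w m] and [w n] lies in [W], so its squared distance to [x] is at least [d];
     this forces [w m - w n] to be small. *)
  have -> : x - w m + (x - w n) = 2%:R *: (x - 2^-1 *: (w m + w n)).
    by rewrite scalerBr scalerA divff ?pnatr_eq0// scale1r scaler_nat mulr2n addrACA opprD.
  have -> : x - w m - (x - w n) = - (w m - w n).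
    by rewrite opprB addrC addrA subrK opprB.
  rewrite normrN normrZ exprMn normr_nat.
  have Wmid : W (2^-1 *: (w m + w n)).
    rewrite -[_ *: _]addr0; apply: (WD) => //.
    by rewrite -[w m]scale1r; exact: WD.
  have := dle _ Wmid.
  have [_ /ltW] := wP m; have [_ /ltW] := wP n.
  move: (`|w m - w n| ^+ 2) (`|x - w m| ^+ 2) (`|x - w n| ^+ 2).
  by move: (`|x - _| ^+ 2) (m.+1%:R^-1) (n.+1%:R^-1) => *; lra.
have [l wl] : exists l : V, w @ \oo --> l.
  apply: (ip_complete H) => e e0.
  have [N _ NP] : \forall n \near \oo, (n.+1%:R^-1 : R) < e ^+ 2 / 4.
    apply: (near_infty_natSinv_lt (PosNum _)); rewrite /= divr_gt0 ?exprn_gt0//.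
  exists N => m n Nm Nn.
  rewrite -(@ler_pXn2r _ 2)// ?nnegrE ?(ltW e0)//.
  have := w2 m n; have := NP m Nm; have := NP n Nn => /=.
  move: (m.+1%:R^-1) (n.+1%:R^-1) (`|_| ^+ 2) (e ^+ 2) => *; lra.
suff xl : x - l = 0.
  move=> e e0; move/subr0_eq: xl => xl.
  have /cvgrPdist_le/(_ _ e0)[N _ /(_ N (leqnn _))] := wl.
  by rewrite -xl => h; exists (w N).
(* The limit [l] may lie outside [W]; the lower bound is inherited from the elements [w n - c *: v]
   of [W]. *)
have zW c v : W v -> d <= `|x - l + c *: v| ^+ 2.
  move=> Wv.
  have cv : `|x - w n + c *: v| ^+ 2 @[n --> \oo] --> `|x - l + c *: v| ^+ 2.
    rewrite expr2; under eq_fun do rewrite expr2.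
    by apply: cvgM; apply: cvg_norm; apply: cvgD; [apply: cvgB => //|
      |apply: cvgB => //|]; exact: cvg_cst.
  rewrite -(cvg_lim (@Rhausdorff R) cv).
  apply: limr_ge; first by apply/cvg_ex; eexists; exact: cv.
  apply: nearW => n.
  have -> : x - w n + c *: v = x - (- c *: v + w n).
    by rewrite scaleNr opprD opprK addrCA addrC.
  by apply: dle; exact: WD.
have zd : `|x - l| ^+ 2 <= d.
  have cv : `|x - w n| ^+ 2 - n.+1%:R^-1 @[n --> \oo] --> `|x - l| ^+ 2 - 0.
    apply: cvgB; last exact: cvg_harmonic.
    rewrite expr2; under eq_fun do rewrite expr2.
    by apply: cvgM; apply: cvg_norm; apply: cvgB => //; exact: cvg_cst.
  rewrite subr0 in cv; rewrite -(cvg_lim (@Rhausdorff R) cv).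
  apply: limr_le; first by apply/cvg_ex; eexists; exact: cv.
  by apply: nearW => n; rewrite lerBlDr; have [_ /ltW] := wP n.
apply: Worth => v Wv; rewrite (ip_sym H).
have [->|v0] := eqVneq v 0; first by rewrite ip_0r.
have v2 : 0 < `|v| ^+ 2 by rewrite exprn_gt0// normr_gt0.
(* The coefficient minimizes the quadratic in [c], so minimality of [x - l] leaves no room for a
   nonzero inner product. *)
have := le_trans zd (zW (- (ip (x - l) v / `|v| ^+ 2)) v Wv).
rewrite normZD2 => h.
have : ip (x - l) v ^+ 2 / `|v| ^+ 2 <= 0.
  rewrite -(lerD2l (`|x - l| ^+ 2)) addr0 -lerBrDr (le_trans h)//.
  by rewrite le_eqVlt; apply/orP; left; apply/eqP; field; rewrite normr_eq0.
rewrite pmulr_lle0 ?invr_gt0// => h2; apply/eqP.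
by rewrite -sqrf_eq0 eq_le h2 sqr_ge0.
Qed.

End hilbert.

(** * The semigroup of a nonnegative self-adjoint operator *)

Section iter_contraction.
Context {R : realType} {V : normedModType R}.
Implicit Types P Q : V -> V.

Lemma iter_linear P m : linear P -> linear (iter m P).
Proof. by move=> linP; elim: m => // m IHm c x y; rewrite /= IHm linP. Qed.

Lemma iter_contraction P m x :
  (forall y, `|P y| <= `|y|) -> `|iter m P x| <= `|x|.
Proof. by move=> cP; elim: m => //= m; exact: le_trans. Qed.

Lemma linear_sub P x y : linear P -> P (x - y) = P x - P y.
Proof. by move=> linP; rewrite addrC -scaleN1r linP scaleN1r addrC. Qed.

Lemma iter_commute P Q m n x : (forall y, P (Q y) = Q (P y)) ->
  iter m P (iter n Q x) = iter n Q (iter m P x).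
Proof.
move=> PQ; elim: m => //= m ->; elim: n => //= n <-; exact: PQ.
Qed.

(** Telescoping: [P^m - Q^m] is a sum of [m] terms [P^i Q^j (P - Q)], and contractivity bounds each
    of them by [|P x - Q x|]. *)
Lemma iter_sub P Q m x : linear P -> (forall y, `|P y| <= `|y|) ->
  linear Q -> (forall y, `|Q y| <= `|y|) ->
  (forall y, P (Q y) = Q (P y)) ->
  `|iter m P x - iter m Q x| <= m%:R * `|P x - Q x|.
Proof.
move=> linP cP linQ cQ PQ; elim: m => [|m IHm]; first by rewrite subrr normr0 mul0r.
have -> : iter m.+1 P x - iter m.+1 Q x =
    P (iter m P x - iter m Q x) + iter m Q (P x - Q x).
  rewrite (linear_sub _ _ linP) (linear_sub _ _ (iter_linear m linQ)).
  have -> : iter m Q (P x) = P (iter m Q x).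
    by elim: m {IHm} => //= m ->.
  by rewrite addrA subrK -[iter m Q (Q x)]iterSr.
rewrite (le_trans (ler_normD _ _))// -natr1 mulrDl mul1r lerD//.
  exact: le_trans (cP _) IHm.
exact: iter_contraction.
Qed.

End iter_contraction.

Section selfadjoint.
Context {R : realType} {V : normedModType R} {ip : V -> V -> R}.
Context (H : hilbert ip) {A : set (V * V)}.
Context (Alin : linear_operator A) (Anneg : nonneg_operator ip A)
  (Asa : selfadjoint ip A)
  (Adense : forall x e, 0 < e -> exists2 d, dom A d & `|x - d| <= e).
Implicit Types x y z w q : V.

Let A0 : A (0, 0).
Proof. by case: Alin. Qed.

Let AD c x y z w : A (x, y) -> A (z, w) -> A (c *: x + z, c *: y + w).
Proof. by case: Alin => _ _; exact. Qed.

Let AB x y z w : A (x, y) -> A (z, w) -> A (x - z, y - w).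
Proof.
move=> xy zw; have := AD (-1) zw xy.
by rewrite !scaleN1r ![- _ + _]addrC.
Qed.

Lemma selfadjoint_sym x y z w : A (x, y) -> A (z, w) -> ip y z = ip x w.
Proof. by rewrite -[in X in _ -> X -> _]Asa => xy /(_ _ _ xy). Qed.

(** Adjoints are closed: for a fixed [(z, w)] in the graph, the defining identity is continuous in
    [(x, y)]. *)
Lemma selfadjoint_closed (u v : V ^nat) x y :
  (forall n, A (u n, v n)) -> u @ \oo --> x -> v @ \oo --> y -> A (x, y).
Proof.
move=> Auv ux vy; rewrite -Asa => z w zw /=.
rewrite (ip_sym H) (ip_sym H z).
rewrite -(cvg_lim (@Rhausdorff R) (cvg_ipl (y := w) H ux)).
under eq_fun do rewrite -(selfadjoint_sym (Auv _) zw).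
by apply/cvg_lim; [exact: Rhausdorff|exact: cvg_ipl].
Qed.

(** * Resolvents of a nonnegative self-adjoint operator *)

Lemma norm_le_add_scale t x w : 0 <= t -> A (x, w) -> `|x| <= `|x + t *: w|.
Proof.
move=> t0 xw; rewrite -(@ler_pXn2r _ 2)// ?nnegrE//.
rewrite (normZD2 H) -addrA lerDl addr_ge0// ?mulr_ge0 ?sqr_ge0//.
by rewrite (ip_sym H); exact: Anneg.
Qed.

Lemma resolvent_inj t x w z q : 0 <= t -> A (x, w) -> A (z, q) ->
  x + t *: w = z + t *: q -> x = z.
Proof.
move=> t0 xw zq e; apply/subr0_eq/eqP; rewrite -normr_eq0 eq_le normr_ge0 andbT.
rewrite (le_trans (norm_le_add_scale t0 (AB xw zq)))// scalerBr.
by rewrite addrACA -opprD e subrr normr0.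
Qed.

(** The range of [1 + t A] is dense: a vector [z] orthogonal to it satisfies [A z = - t^-1 z] by
    self-adjointness, and nonnegativity forces [z = 0]. It is closed: by [norm_le_add_scale] the
    preimages of a convergent sequence are Cauchy, and [A] is closed. *)
Lemma resolvent_surj t y : 0 < t -> exists p, A p /\ p.1 + t *: p.2 = y.
Proof.
move=> t0.
pose W : set V := [set z | exists x w, A (x, w) /\ z = x + t *: w].
have W0 : W 0 by exists 0, 0; split => //; rewrite scaler0 addr0.
have WD c z1 z2 : W z1 -> W z2 -> W (c *: z1 + z2).
  move=> [x1 [w1 [A1 ->]]] [x2 [w2 [A2 ->]]].
  exists (c *: x1 + x2), (c *: w1 + w2); split; first exact: AD.
  by rewrite !scalerDr !scalerA [c * t]mulrC addrACA.
have Worth z : (forall w, W w -> ip w z = 0) -> z = 0.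
  move=> zW.
  have zA : A (z, - t^-1 *: z).
    rewrite -Asa => x w xw /=.
    have := zW (x + t *: w); rewrite (ip_addl H) (ip_scalel H) => h.
    rewrite (ip_scaler H); apply: (mulfI (lt0r_neq0 t0)).
    rewrite mulNr mulrN mulVKf ?gt_eqF//; apply/eqP; rewrite -addr_eq0 addrC.
    by apply/eqP; apply: h; exists x, w.
  have := norm_le_add_scale (ltW t0) zA.
  rewrite scalerA mulrN divff ?gt_eqF// scaleN1r subrr normr0 => z0.
  by apply/eqP; rewrite -normr_le0.
have dW := dense_of_trivial_orthogonal H W0 WD Worth y.
have /choice[p pP] n : exists p, A p /\ `|y - (p.1 + t *: p.2)| <= n.+1%:R^-1.
  have e0 : 0 < n.+1%:R^-1 :> R by rewrite invr_gt0.
  have [_ [x [w [xw ->]]] xwe] := dW _ e0.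
  by exists (x, w).
pose f n := (p n).1 + t *: (p n).2.
have fy : f @ \oo --> y.
  apply: (le_cvg0 (b := fun n => n.+1%:R^-1)); last exact: cvg_harmonic.
  by move=> n; rewrite distrC; have [] := pP n.
have [x px] : exists x : V, (p n).1 @[n --> \oo] --> x.
  apply: (ip_complete H) => e e0.
  have e20 : 0 < e / 2 by rewrite divr_gt0.
  have /cvgrPdist_le/(_ _ e20)[N _ NP] := fy.
  exists N => m n Nm Nn.
  have [Am _] := pP m; have [An _] := pP n.
  rewrite (surjective_pairing (p m)) in Am.
  rewrite (surjective_pairing (p n)) in An.
  have := norm_le_add_scale (ltW t0) (AB Am An) => /le_trans; apply.
  rewrite scalerBr addrACA -opprD -/(f m) -/(f n).
  have -> : f m - f n = (y - f n) - (y - f m) by rewrite opprB [RHS]addrC addrA subrK.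
  rewrite (le_trans (ler_normB _ _))// [leRHS](splitr e) lerD//; exact: NP.
exists (x, t^-1 *: (y - x)); split => /=; last first.
  by rewrite scalerA divff ?gt_eqF// scale1r subrKC.
apply: (@selfadjoint_closed (fun n => (p n).1) (fun n => (p n).2)) => //.
  by move=> n; rewrite -surjective_pairing; have [] := pP n.
have -> : (fun n => (p n).2) = fun n => t^-1 *: (f n - (p n).1).
  apply/funext => n; rewrite /f addrC addKr scalerA mulVf ?gt_eqF//.
  by rewrite scale1r.
by apply: cvgZr; exact: cvgB.
Qed.

(* (1 + t A)^-1 for [t > 0], extended by the identity. *)
Definition resolvent t y : V :=
  if pselect (0 < t) is left t0 then (projT1 (cid (resolvent_surj y t0))).1
  else y.

Local Notation J := resolvent.

(** At [t = 0] the resolvent is the identity and [y] may lie outside the domain, hence the guard on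
    the membership; the witness is then 0. *)
Lemma resolventP t y : 0 <= t -> exists2 w, (0 < t -> A (J t y, w)) & J t y + t *: w = y.
Proof.
rewrite /resolvent; case: pselect => [t0 _|t0].
  by case: cid => -[x w] /= [xw e]; exists w.
by rewrite le_eqVlt => /predU1P[<-|//]; exists 0; rewrite ?ltxx// scale0r addr0.
Qed.

Lemma resolvent0 y : J 0 y = y.
Proof. by have [w _] := resolventP y (lexx 0); rewrite scale0r addr0. Qed.

Lemma resolventE t x w : 0 <= t -> A (x, w) -> J t (x + t *: w) = x.
Proof.
rewrite le_eqVlt => /predU1P[<- _|t0 xw].
  by rewrite scale0r addr0 resolvent0.
have [w' + e] := resolventP (x + t *: w) (ltW t0).
by move=> /(_ t0) Aw'; exact: (resolvent_inj (ltW t0) Aw' xw).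
Qed.

Lemma resolvent_linear t : 0 <= t -> linear (J t).
Proof.
move=> t0 c x y; have [t_eq|t_neq] := eqVneq t 0.
  by rewrite t_eq !resolvent0.
have tgt0 : 0 < t by rewrite lt_def t_neq.
have [wx /(_ tgt0) Ax ex] := resolventP x t0.
have [wy /(_ tgt0) Ay ey] := resolventP y t0.
rewrite -[in LHS]ex -[in LHS]ey scalerDr addrACA !scalerA (mulrC c t) -scalerA.
by rewrite -scalerDr resolventE//; exact: AD.
Qed.

Lemma resolvent_contraction t x : 0 <= t -> `|J t x| <= `|x|.
Proof.
rewrite le_eqVlt => /predU1P[<-|t0]; first by rewrite resolvent0.
have [w /(_ t0) Ax ex] := resolventP x (ltW t0).
by rewrite -[in leRHS]ex norm_le_add_scale// ltW.
Qed.

Lemma resolvent_sym t x y : 0 <= t -> ip (J t x) y = ip x (J t y).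
Proof.
rewrite le_eqVlt => /predU1P[<-|t0]; first by rewrite !resolvent0.
have [w /(_ t0) Ax ex] := resolventP x (ltW t0).
have [z /(_ t0) Ay ey] := resolventP y (ltW t0).
rewrite -[in LHS]ey -[in RHS]ex (ip_addr H) (ip_addl H) (ip_scalel H) (ip_scaler H).
by rewrite (selfadjoint_sym Ax Ay).
Qed.

(** The resolvent commutes with [A]: applying it to [x + t *: w] and comparing with
    [J t x + t *: z = x] identifies [z] with [J t w]. *)
Lemma resolvent_graph t x w : 0 <= t -> A (x, w) -> A (J t x, J t w).
Proof.
rewrite le_eqVlt => /predU1P[<- xw|t0 xw]; first by rewrite !resolvent0.
have [z /(_ t0) Az ez] := resolventP x (ltW t0).
suff -> : J t w = z by [].
have := resolventE (ltW t0) xw; rewrite addrC resolvent_linear ?ltW// => e.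
apply: (scalerI (lt0r_neq0 t0)).
by apply: (addIr (J t x)); rewrite e addrC.
Qed.

Lemma resolvent_comm s t x : 0 <= s -> 0 <= t -> J s (J t x) = J t (J s x).
Proof.
move=> s0; rewrite le_eqVlt => /predU1P[<-|t0]; first by rewrite !resolvent0.
have [w /(_ t0) Ax ex] := resolventP x (ltW t0).
have := resolventE (ltW t0) (resolvent_graph s0 Ax).
by rewrite addrC -resolvent_linear// addrC ex.
Qed.

Lemma resolvent_eq t x w : 0 <= t -> A (x, w) -> x = J t x + t *: J t w.
Proof. by move=> t0 /(resolventE t0); rewrite addrC resolvent_linear// addrC. Qed.

Lemma resolvent_sub t x w : 0 <= t -> A (x, w) -> x - J t x = t *: J t w.
Proof. by move=> t0 xw; apply/eqP; rewrite subr_eq addrC -resolvent_eq. Qed.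

(* (1 + s A) (1 + t A) = 1 + (s + t) A + s t A^2 *)
Lemma resolvent_mul s t x w q : 0 <= s -> 0 <= t -> A (x, w) -> A (w, q) ->
  `|J s (J t x) - J (s + t) x| <= s * t * `|q|.
Proof.
move=> s0 t0 xw wq; have st0 : 0 <= s + t by exact: addr_ge0.
have Ay := resolvent_graph st0 xw; have Aw := resolvent_graph st0 wq.
have e1 : x = J (s + t) x + (s + t) *: J (s + t) w. by exact: resolvent_eq.
(* [J s J t] inverts [(1 + t A) (1 + s A)]; at [J (s + t) x] this product exceeds
   [(1 + (s + t) A) J (s + t) x = x] by [s t A^2 J (s + t) x]. *)
have e2 : J s (J t (x + (s * t) *: J (s + t) q)) = J (s + t) x.
  have Ast := AD s Aw Ay.
  rewrite [in X in J t X]e1.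
  have -> : J (s + t) x + (s + t) *: J (s + t) w + (s * t) *: J (s + t) q =
    (s *: J (s + t) w + J (s + t) x) + t *: (s *: J (s + t) q + J (s + t) w).
    rewrite scalerDl scalerDr scalerA (mulrC t s) [in RHS]addrACA.
    by rewrite [in RHS]addrC [in RHS]addrACA -!addrA; congr (_ + _).
  by rewrite resolventE// addrC resolventE.
rewrite -[in X in _ - X]e2 (addrC x) !resolvent_linear//.
rewrite opprD addrCA subrr addr0 normrN normrZ ger0_norm ?mulr_ge0//.
by rewrite ler_wpM2l ?mulr_ge0// !(le_trans (resolvent_contraction _ _)).
Qed.

Lemma resolvent_iter_comm s t m n x : 0 <= s -> 0 <= t ->
  iter m (J s) (iter n (J t) x) = iter n (J t) (iter m (J s) x).
Proof.
by move=> s0 t0; apply: iter_commute => y; exact: resolvent_comm.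
Qed.

(** * The dyadic Euler scheme and its limit *)

Definition euler n t x := iter (2 ^ n) (J (t / 2 ^+ n)) x.

Definition euler_limit t x : V := lim (euler n t x @[n --> \oo]).

Local Notation T := euler_limit.

Let div2X_ge0 n (t : R) : 0 <= t -> 0 <= t / 2 ^+ n.
Proof. by move=> t0; rewrite divr_ge0// exprn_ge0. Qed.

Lemma euler_linear n t : 0 <= t -> linear (euler n t).
Proof. by move=> t0; apply/iter_linear/resolvent_linear/div2X_ge0. Qed.

Lemma euler_contraction n t x : 0 <= t -> `|euler n t x| <= `|x|.
Proof.
by move=> t0; apply: iter_contraction => y; exact/resolvent_contraction/div2X_ge0.
Qed.

Lemma euler_sym n t x y : 0 <= t -> ip (euler n t x) y = ip x (euler n t y).
Proof.
move=> t0; rewrite /euler; elim: (2 ^ n)%N y => // m IHm y.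
by rewrite iterS resolvent_sym ?div2X_ge0// IHm -iterSr.
Qed.

(** Each of the [2 ^ n] steps costs [(s / 2^n) (t / 2^n) |q|] by [resolvent_mul], and [iter_sub]
    adds the errors up. *)
Lemma euler_mul n s t x w q : 0 <= s -> 0 <= t -> A (x, w) -> A (w, q) ->
  `|euler n s (euler n t x) - euler n (s + t) x| <= s * t * `|q| / 2 ^+ n.
Proof.
move=> s0 t0 xw wq.
have [s'0 t'0] := (div2X_ge0 n s0, div2X_ge0 n t0).
have st'0 := div2X_ge0 n (addr_ge0 s0 t0).
have -> : euler n s (euler n t x) =
    iter (2 ^ n) (J (s / 2 ^+ n) \o J (t / 2 ^+ n)) x.
  rewrite /euler; elim: (2 ^ n)%N => //= m <-; congr (J _ _).
  by rewrite -[RHS](@resolvent_iter_comm _ _ m 1)//= -iterSr.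
have := @resolvent_mul (s / 2 ^+ n) (t / 2 ^+ n) x w q s'0 t'0 xw wq.
rewrite -mulrDl => h.
rewrite (le_trans (iter_sub _ _ _ _ _ _ _))//.
- by move=> c y z; rewrite /= !resolvent_linear.
- by move=> y; rewrite /= !(le_trans (resolvent_contraction _ _)).
- exact: resolvent_linear.
- by move=> y; exact: resolvent_contraction.
- by move=> y /=; rewrite (resolvent_comm _ t'0)// (resolvent_comm _ s'0).
have /= := ler_wpM2l (ler0n _ (2 ^ n)) h => /le_trans; apply.
by rewrite natrX le_eqVlt; apply/orP; left; apply/eqP; field.
Qed.

(** This is what powers of two are for: consecutive levels are compared by [euler_mul] with both
    times equal to [t / 2]. *)
Lemma euler_half n t x : euler n.+1 t x = euler n (t / 2) (euler n (t / 2) x).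
Proof.
rewrite /euler -iterD addnn -mul2n -expnS.
by congr (iter _ (J _)); rewrite exprS invfM mulrA.
Qed.

Lemma euler_succ n t x w q : 0 <= t -> A (x, w) -> A (w, q) ->
  `|euler n.+1 t x - euler n t x| <= t ^+ 2 / 4 * `|q| / 2 ^+ n.
Proof.
move=> t0 xw wq; have t20 : 0 <= t / 2 by rewrite divr_ge0.
rewrite euler_half [in X in _ - X](_ : t = t / 2 + t / 2); last by rewrite -splitr.
apply: le_trans (euler_mul n t20 t20 xw wq) _.
by rewrite le_eqVlt; apply/orP; left; apply/eqP; field.
Qed.

(** The bound is a difference so that the induction on [k] closes exactly: one more level costs
    [t^2 / 4] times [1 / 2^(n + k)], which is [t^2 / 2] times the decrease of [1 / 2^(n + k)]. *)
Lemma euler_cauchy k n t x w q : 0 <= t -> A (x, w) -> A (w, q) ->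
  `|euler (n + k) t x - euler n t x| <=
    t ^+ 2 / 2 * `|q| * ((2 ^+ n)^-1 - (2 ^+ (n + k))^-1).
Proof.
move=> t0 xw wq; elim: k => [|k IHk]; first by rewrite addn0 !subrr normr0 mulr0.
rewrite addnS.
have := ler_normD (euler (n + k).+1 t x - euler (n + k) t x)
  (euler (n + k) t x - euler n t x).
rewrite addrA subrK => /le_trans; apply.
apply: le_trans (lerD (euler_succ (n + k) t0 xw wq) IHk) _.
rewrite [2 ^+ _.+1]exprS invfM; move: (2 ^+ (n + k))^-1 (2 ^+ n)^-1 => u v.
by rewrite le_eqVlt; apply/orP; left; apply/eqP; field.
Qed.

(** [J s] maps [dom A] into the domain of [A^2], since [A J s d = J s A d] is again in the range of
    [J s]; and [J s d] is within [s |A d|] of [d]. *)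
Lemma dense_dom_sqr x e : 0 < e ->
  exists z w q, [/\ A (z, w), A (w, q) & `|x - z| <= e].
Proof.
move=> e0; have e20 : 0 < e / 2 by rewrite divr_gt0.
have [d [w dw] xd] := Adense x e20.
pose s := e / 2 / (`|w| + 1).
have w0 : 0 < `|w| + 1 by rewrite ltr_wpDl.
have s0 : 0 < s by rewrite divr_gt0.
have [q /(_ s0) wq _] := resolventP w (ltW s0).
exists (J s d), (J s w), q; split => //; first exact: resolvent_graph (ltW s0) dw.
rewrite [leRHS]splitr -[x - _](subrKA d) (le_trans (ler_normD _ _))// lerD//.
rewrite (resolvent_sub (ltW s0) dw) normrZ gtr0_norm//.
apply: (@le_trans _ _ (s * `|w|)).
  by rewrite ler_wpM2l ?(ltW s0)// resolvent_contraction ?ltW.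
by rewrite /s mulrAC ler_pdivrMr// ler_wpM2l ?lerDl// ltW.
Qed.

(** On the domain of [A^2] the scheme is Cauchy by [euler_cauchy]; contractivity, uniform in [n],
    extends this to all [x] by density. *)
Lemma euler_cvg t x : 0 <= t -> euler n t x @[n --> \oo] --> T t x.
Proof.
move=> t0; suff [l] : exists l : V, euler n t x @[n --> \oo] --> l by move/cvgP.
apply: (ip_complete H) => e e0; have e30 : 0 < e / 3 by rewrite divr_gt0.
have [z [w [q [zw wq xz]]]] := dense_dom_sqr x e30.
have C0 : 0 <= t ^+ 2 / 2 * `|q| by rewrite !mulr_ge0 ?sqr_ge0.
have [N _ NP] : \forall n \near \oo, t ^+ 2 / 2 * `|q| / 2 ^+ n <= e / 3.
  have /cvgrPdist_le/(_ _ e30) := @cvg_div2X0 R (t ^+ 2 / 2 * `|q|).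
  by apply: filterS => n; rewrite sub0r normrN; exact: le_trans (ler_norm _).
exists N => m n; wlog nm : m n / (n <= m)%N.
  move=> h; have [|/ltnW] := leqP n m; first exact: h.
  by move=> mn Nm Nn; rewrite distrC; exact: h.
move=> Nm Nn; rewrite -(subnKC nm).
set k := (m - n)%N.
have ez l : `|euler l t x - euler l t z| <= e / 3.
  by rewrite -(linear_sub _ _ (euler_linear l t0)) (le_trans (euler_contraction _ _ t0)).
have -> : euler (n + k) t x - euler n t x =
    (euler (n + k) t x - euler (n + k) t z) +
    (euler (n + k) t z - euler n t z) - (euler n t x - euler n t z).
  by rewrite subrKA opprB addrA subrK.
rewrite (le_trans (ler_normB _ _))//.
have -> : e = e / 3 + e / 3 + e / 3 by field.
rewrite lerD// (le_trans (ler_normD _ _))// lerD//.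
rewrite (le_trans (euler_cauchy k n t0 zw wq))// (le_trans _ (NP n Nn))//.
by rewrite ler_wpM2l// gerBl invr_ge0 exprn_ge0.
Qed.

Lemma euler_limit_linear t : 0 <= t -> linear (T t).
Proof.
move=> t0 c x y; apply/cvg_lim; first exact: norm_hausdorff.
under eq_cvg do rewrite (euler_linear _ t0).
by apply: cvgD; [apply: cvgZr|]; exact: euler_cvg.
Qed.

Lemma euler_limit_contraction t x : 0 <= t -> `|T t x| <= `|x|.
Proof.
by move=> t0; apply: cvg_le_norm (@euler_cvg _ x t0) _ => n; exact: euler_contraction.
Qed.

Lemma euler_limit_sym t x y : 0 <= t -> ip (T t x) y = ip x (T t y).
Proof.
move=> t0; rewrite -(cvg_lim (@Rhausdorff R) (cvg_ipl (y := y) H (@euler_cvg _ x t0))).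
rewrite (ip_sym H x) -(cvg_lim (@Rhausdorff R) (cvg_ipl (y := x) H (@euler_cvg _ y t0))).
by under eq_fun do rewrite euler_sym// (ip_sym H).
Qed.

Lemma euler_limit0 x : T 0 x = x.
Proof.
apply/cvg_lim; first exact: norm_hausdorff.
have -> : (fun n => euler n 0 x) = fun=> x; last exact: cvg_cst.
apply/funext => n; rewrite /euler mul0r.
by elim: (2 ^ n)%N => //= m ->; rewrite resolvent0.
Qed.

(** On the domain of [A^2] the defect of the semigroup law at level [n] is of order [1 / 2^n] by
    [euler_mul]; density and contractivity do the rest. *)
Lemma euler_limit_mul s t x : 0 <= s -> 0 <= t -> T (s + t) x = T s (T t x).
Proof.
move=> s0 t0; have st0 : 0 <= s + t by exact: addr_ge0.
have linst := euler_limit_linear st0; have lins := euler_limit_linear s0.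
have lint := euler_limit_linear t0.
apply/esym/subr0_eq/eq_0_of_norm_lt => e e0.
have e20 : 0 < e / 2 by rewrite divr_gt0.
have [z [w [q [zw wq xz]]]] := dense_dom_sqr x e20.
have Tz : T s (T t z) = T (s + t) z.
  apply/esym/cvg_lim; first exact: norm_hausdorff.
  apply: (le_cvg0 (b := fun n => s * t * `|q| / 2 ^+ n +
      (`|euler n t z - T t z| + `|euler n s (T t z) - T s (T t z)|))).
    move=> n; rewrite -[_ - T s _](subrKA (euler n s (euler n t z))).
    rewrite (le_trans (ler_normD _ _))// lerD//.
      by rewrite distrC; exact: euler_mul zw wq.
    rewrite -[_ - T s _](subrKA (euler n s (T t z))) (le_trans (ler_normD _ _))//.
    rewrite lerD// -(linear_sub _ _ (euler_linear n s0)).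
    exact: euler_contraction.
  rewrite -[X in _ --> X](addr0 0); apply: cvgD; first exact: cvg_div2X0.
  rewrite -[X in _ --> X](addr0 0); apply: cvgD.
    rewrite -[X in _ --> X](@normr0 _ V) -(subrr (T t z)); apply: cvg_norm.
    by apply: cvgB; [exact: euler_cvg|exact: cvg_cst].
  rewrite -[X in _ --> X](@normr0 _ V) -(subrr (T s (T t z))); apply: cvg_norm.
  by apply: cvgB; [exact: euler_cvg|exact: cvg_cst].
have -> : T s (T t x) - T (s + t) x = T s (T t (x - z)) - T (s + t) (x - z).
  rewrite (linear_sub _ _ lint) (linear_sub _ _ lins) (linear_sub _ _ linst).
  by rewrite Tz opprB addrA subrK.
rewrite (le_trans (ler_normB _ _))// [leRHS]splitr lerD//.
  by rewrite !(le_trans (euler_limit_contraction _ _)).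
by rewrite (le_trans (euler_limit_contraction _ _)).
Qed.

(** * Small times and the generator *)

Lemma euler_limit_sub_id t x w : 0 <= t -> A (x, w) -> `|T t x - x| <= t * `|w|.
Proof.
move=> t0 xw; apply: (@cvg_le_norm _ _ (fun n => euler n t x - x)).
  by apply: cvgB; [exact: euler_cvg|exact: cvg_cst].
(* Viewing the identity as an iterate lets [iter_sub] sum [2 ^ n] errors of size at most
   [(t / 2^n) |w|]. *)
move=> n; have -> : euler n t x - x = euler n t x - iter (2 ^ n) id x.
  by congr (_ - _); elim: (2 ^ n)%N.
have t'0 := div2X_ge0 n t0.
rewrite (le_trans (iter_sub _ _ _ _ _ _ _))//.
- exact: resolvent_linear.
- by move=> y; exact: resolvent_contraction.
rewrite distrC (resolvent_sub t'0 xw) normrZ (ger0_norm t'0).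
have : `|J (t / 2 ^+ n) w| <= `|w| by exact: resolvent_contraction.
move=> /(ler_wpM2l t0); apply: le_trans.
by rewrite natrX le_eqVlt; apply/orP; left; apply/eqP; field.
Qed.

(** Level 0 of the scheme is [J t] itself. The bound is quadratic in [t], so it disappears from
    difference quotients at 0. *)
Lemma euler_limit_sub_resolvent t x w q : 0 <= t -> A (x, w) -> A (w, q) ->
  `|T t x - J t x| <= t ^+ 2 / 2 * `|q|.
Proof.
move=> t0 xw wq; apply: (@cvg_le_norm _ _ (fun n => euler n t x - J t x)).
  by apply: cvgB; [exact: euler_cvg|exact: cvg_cst].
move=> n; have := euler_cauchy n 0 t0 xw wq.
rewrite add0n {2}/euler/= expr0 divr1 => /le_trans; apply.
by rewrite ler_piMr ?mulr_ge0 ?sqr_ge0// invr1 gerBl invr_ge0 exprn_ge0.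
Qed.

Lemma euler_limit_cvg0 x : T t x @[t --> 0^'+] --> x.
Proof.
apply/cvgrPdist_le => e e0; have e30 : 0 < e / 3 by rewrite divr_gt0.
have [z [w zw] xz] := Adense x e30.
have w0 : 0 < `|w| + 1 by rewrite ltr_wpDl.
near=> t.
have t0 : 0 <= t by near: t; exact: nbhs_right_ge.
have tw : t * `|w| <= e / 3.
  apply: (@le_trans _ _ (t * (`|w| + 1))); first by rewrite ler_wpM2l// lerDl.
  rewrite -ler_pdivlMr//; near: t; apply: nbhs_right_le.
  by rewrite divr_gt0.
have -> : x - T t x = (x - z) - (T t z - z) - T t (x - z).
  rewrite (linear_sub _ _ (euler_limit_linear t0)) !opprB.
  by rewrite -addrA !subrKA.
rewrite (le_trans (ler_normB _ _))//.
have -> : e = e / 3 + e / 3 + e / 3 by field.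
rewrite lerD//; last by rewrite (le_trans (euler_limit_contraction _ _)).
rewrite (le_trans (ler_normB _ _))// lerD//.
exact: le_trans (euler_limit_sub_id t0 zw) tw.
Unshelve. all: by end_near. Qed.

Lemma selfadjoint_C0_contraction_semigroup : C0_contraction_semigroup T.
Proof.
split.
- exact: euler_limit_linear.
- exact: euler_limit0.
- by move=> s t x s0 t0; exact: euler_limit_mul.
- exact: euler_limit_cvg0.
- by move=> t x; exact: euler_limit_contraction.
Qed.

Lemma resolvent_approx x e : 0 < e -> exists2 s, 0 < s & `|x - J s x| <= e.
Proof.
move=> e0; have e30 : 0 < e / 3 by rewrite divr_gt0.
have [d [w dw] xd] := Adense x e30.
have w0 : 0 < `|w| + 1 by rewrite ltr_wpDl.
pose s := e / 3 / (`|w| + 1).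
have s0 : 0 < s by rewrite divr_gt0.
exists s => //.
have -> : x - J s x = (x - d) + (d - J s d) - J s (x - d).
  rewrite (linear_sub _ _ (resolvent_linear (ltW s0))) opprB.
  by rewrite -addrA !subrKA.
rewrite (le_trans (ler_normB _ _))//.
have -> : e = e / 3 + e / 3 + e / 3 by field.
rewrite lerD//; last by rewrite (le_trans (resolvent_contraction _ (ltW s0))).
rewrite (le_trans (ler_normD _ _))// lerD//.
rewrite (resolvent_sub (ltW s0) dw) normrZ gtr0_norm//.
apply: (@le_trans _ _ (s * `|w|)).
  by rewrite ler_wpM2l ?(ltW s0)// resolvent_contraction ?ltW.
by rewrite /s mulrAC ler_pdivrMr// ler_wpM2l ?lerDl// ltW.
Qed.

(* Approximate [x] by [z = J s x], which lies in the domain of [A^2]: the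
   difference quotients at [x - z] are bounded by [`|A (x - z)|], uniformly in
   [h], and [A z = J s (A x)] is close to [A x]. *)
Lemma euler_limit_generator x w : A (x, w) ->
  h^-1 *: (T h x - x) @[h --> 0^'+] --> - w.
Proof.
move=> xw; apply/cvgrPdist_le => e e0; have e40 : 0 < e / 4 by rewrite divr_gt0.
have [s s0 ws] := resolvent_approx w e40.
have zw' := resolvent_graph (ltW s0) xw.
have [q /(_ s0) wq _] := resolventP w (ltW s0).
set z := J s x in zw'; set w' := J s w in zw' ws wq.
have q0 : 0 < `|q| + 1 by rewrite ltr_wpDl.
near=> h.
have h0 : 0 < h by near: h; exact: nbhs_right_gt.
have hq : h * `|q| <= e / 4.
  apply: (@le_trans _ _ (h * (`|q| + 1))); first by rewrite ler_wpM2l ?lerDl// ltW.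
  rewrite -ler_pdivlMr//; near: h; apply: nbhs_right_le.
  by rewrite divr_gt0.
have linT := euler_limit_linear (ltW h0).
have hV (y : V) (c : R) : `|y| <= h * c -> `|h^-1 *: y| <= c.
  by move=> yc; rewrite normrZ gtr0_norm ?invr_gt0// ler_pdivrMl.
(* Four errors of size [e / 4]: [w] against [w'], the quotient at [x - z], the second-order gap
   between [T h z] and [J h z], and [w'] against [J h w'], the last from
   [z - J h z = h *: J h w']. *)
have -> : - w - h^-1 *: (T h x - x) =
    - (w - w') - (h^-1 *: (T h (x - z) - (x - z)) +
    (h^-1 *: (T h z - J h z) + (w' - J h w'))).
  have -> : T h x - x = (T h (x - z) - (x - z)) + ((T h z - J h z) - (z - J h z)).
    by rewrite !opprB subrKA (linear_sub _ _ linT) addrAC !subrKA.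
  rewrite (resolvent_sub (ltW h0) zw') (scalerDr _ (T h _ - _)).
  rewrite (scalerDr _ (T h z - _)) scalerN scalerA mulVf ?gt_eqF//.
  rewrite scale1r; move: (h^-1 *: _) (h^-1 *: _) (J h w') => b a c.
  by rewrite [in RHS](addrCA b) [in RHS](addrCA a) -!opprD subrKA.
rewrite (le_trans (ler_normB _ _))// normrN.
have -> : e = e / 4 + (e / 4 + (e / 4 + e / 4)) by field.
rewrite lerD// (le_trans (ler_normD _ _))// lerD//.
  apply: hV; apply: (le_trans (euler_limit_sub_id (ltW h0) (AB xw zw'))).
  by rewrite ler_wpM2l ?(ltW h0).
rewrite (le_trans (ler_normD _ _))// lerD//.
  apply: hV; apply: (le_trans (euler_limit_sub_resolvent (ltW h0) zw' wq)).
  rewrite expr2 -!mulrA ler_wpM2l ?(ltW h0)//.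
  apply: le_trans hq; rewrite ler_wpM2l ?(ltW h0)// ler_piMl//.
  by rewrite invf_le1// ler1n.
rewrite (resolvent_sub (ltW h0) wq) normrZ gtr0_norm//.
apply: le_trans hq; rewrite ler_wpM2l ?(ltW h0)//.
by rewrite resolvent_contraction ?ltW.
Unshelve. all: by end_near. Qed.

(** One inclusion is [euler_limit_generator]. Conversely [T h] is symmetric, so a derivative [y] of
    the semigroup at [x] satisfies [<y, z> = - <x, A z>] for [z] in the domain: [(x, - y)] is in the
    adjoint of [A], that is in [A]. *)
Theorem selfadjoint_generates :
  generates_contraction_semigroup (opp_operator A).
Proof.
exists T; split; first exact: selfadjoint_C0_contraction_semigroup.
apply/seteqP; split => -[x y] /=; last first.
  by rewrite /opp_operator/= => /euler_limit_generator; rewrite opprK.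
rewrite /generator/opp_operator/= => xy; rewrite -Asa => z w zw /=.
rewrite (ip_oppr H) (ip_sym H) -(ip_sym H y).
have yz : ip (h^-1 *: (T h x - x)) z @[h --> 0^'+] --> ip y z by exact: cvg_ipl.
have wx : ip (h^-1 *: (T h z - z)) x @[h --> 0^'+] --> ip (- w) x.
  by apply: (cvg_ipl H); exact: euler_limit_generator.
have wx' : ip (h^-1 *: (T h x - x)) z @[h --> 0^'+] --> ip (- w) x.
  apply: cvg_trans wx; apply: near_eq_cvg; near=> h.
  have h0 : 0 < h by near: h; exact: nbhs_right_gt.
  rewrite !(ip_scalel H) !(ip_subl H) (ip_sym H _ x) -euler_limit_sym ?ltW//.
  by rewrite (ip_sym H z).
apply/oppr_inj; rewrite opprK -(cvg_lim (@Rhausdorff R) yz).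
by rewrite (cvg_lim (@Rhausdorff R) wx') (ip_oppl H) (ip_sym H).
Unshelve. all: by end_near.
Qed.

End selfadjoint.

(** * Completeness of the weighted space *)

Section L2_complete.
Context d (T : measurableType d) (R : realType).
Variable mu : {measure set T -> \bar R}.
Implicit Types f g h : T -> R.

Lemma Lfun2_of_sqr_lty f : measurable_fun setT f ->
  (\int[mu]_x (f x ^+ 2)%:E < +oo)%E -> f \in Lfun mu 2%:E.
Proof.
move=> mf foo; apply/andP; split; rewrite inE//=.
rewrite /finite_norm unlock; apply: poweR_lty.
under eq_integral => x _ do rewrite /= powR_mulrn// real_normK ?num_real//.
exact: foo.
Qed.

Lemma L2_of_sqr_lty f : measurable_fun setT f ->
  (\int[mu]_x (f x ^+ 2)%:E < +oo)%E ->
  exists l : L2 mu, {ae mu, forall x, l x = f x}.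
Proof.
move=> mf /(Lfun2_of_sqr_lty mf) Lf.
by exists (\pi_(L2 mu) (Lfun_Sub (lee1n 2) Lf))%qT; exact: L2_piE.
Qed.

Lemma cvgn_of_geometric (v : R ^nat) (C : R) :
  (forall j, `|v j.+1 - v j| <= C * 2^-1 ^+ j) -> cvgn v.
Proof.
move=> vC; rewrite (_ : v = fun n => v 0%N + series (telescope v) n); last first.
  by apply/funext => n; exact: eq_sum_telescope.
apply: is_cvgD; first exact: is_cvg_cst.
apply: normed_cvg.
apply: (@series_le_cvg _ _ (geometric C 2^-1)) => //.
- by move=> n /=.
- move=> n; exact: le_trans (normr_ge0 _) (vC n).
- apply: is_cvg_geometric_series.
  by rewrite ger0_norm// invf_lt1// ltr1n.
Qed.

(* By Tonelli the series of the [4^j (u_{j+1} - u_j)^2] is finite a.e., which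
   bounds the increments by a geometric sequence. *)
Lemma ae_cvgn_of_fast (u : (T -> R) ^nat) :
  (forall j, measurable_fun setT (u j)) ->
  (forall j, (\int[mu]_x ((u j.+1 x - u j x) ^+ 2)%:E <= (8^-1 ^+ j)%:E)%E) ->
  {ae mu, forall x, cvgn (u ^~ x)}.
Proof.
move=> mu_ u8.
(* Against the hypothesis [8^-j], the weight [4^j] leaves the summable [2^-j], and a bound on the
   sum still makes the increments of order [2^-j]. *)
pose F j x : \bar R := (4 ^+ j * (u j.+1 x - u j x) ^+ 2)%:E.
have mF j : measurable_fun setT (F j).
  apply/measurable_EFinP; apply: measurable_funM => //.
  by apply: measurable_funX; apply: measurable_funB; exact: mu_.
have F0 j x : (0 <= F j x)%E by rewrite lee_fin mulr_ge0 ?sqr_ge0// exprn_ge0.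
have Foo : (\int[mu]_x (\sum_(j <oo) F j x) < +oo)%E.
  rewrite integral_nneseries//.
  apply: (@le_lt_trans _ _ (\sum_(j <oo) (2^-1 ^+ j)%:E)%E).
    apply: lee_nneseries => j _; first by move=> _; exact: integral_ge0.
    under eq_integral do rewrite /F EFinM.
    rewrite ge0_integralZl_EFin ?exprn_ge0//; last 2 first.
    - by move=> x _; rewrite lee_fin sqr_ge0.
    - apply/measurable_EFinP/measurable_funX/measurable_funB; exact: mu_.
    apply: le_trans (lee_wpmul2l _ (u8 j)) _; first by rewrite lee_fin exprn_ge0.
    rewrite -EFinM lee_fin -exprMn le_eqVlt; apply/orP; left; apply/eqP.
    by congr (_ ^+ _); field.
  rewrite (_ : (fun _ => _) = fun n => (series (geometric 1 2^-1) n)%:E); last first.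
    by apply/funext => n; rewrite sumEFin; congr EFin; apply: eq_bigr => i _; rewrite /= mul1r.
  rewrite EFin_lim; first exact: ltry.
  by apply: is_cvg_geometric_series; rewrite ger0_norm// invf_lt1// ltr1n.
have iF : mu.-integrable setT (fun x => \sum_(j <oo) F j x)%E.
  apply/integrableP; split.
    by apply: ge0_emeasurable_sum => //.
  under eq_integral => x _ do rewrite gee0_abs ?nneseries_ge0//.
  exact: Foo.
have := integrable_ae measurableT iF.
apply: filterS => x /(_ I) Sx.
set S := (\sum_(j <oo) F j x)%E in Sx.
have S0 : (0 <= S)%E by exact: nneseries_ge0.
apply: (@cvgn_of_geometric _ (Num.sqrt (fine S))) => j.
have FS : (F j x <= S)%E.
  apply: le_trans (nneseries_lim_ge j.+1 _) => //.
  rewrite big_nat_recr//= leeDr//; exact: sume_ge0.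
rewrite -(@ler_pXn2r _ 2)// ?nnegrE ?mulr_ge0 ?sqrtr_ge0 ?exprn_ge0//.
rewrite real_normK ?num_real// exprMn sqr_sqrtr ?fine_ge0//.
rewrite -exprM mulnC exprM exprVn -ler_pdivrMr ?invr_gt0 ?exprn_gt0//.
rewrite -(exprVn (2 ^- 2)) invrK mulrC -lee_fin fineK// -natrX; exact: FS.
Qed.

(** Indices of a fast subsequence: from rank [j] on they stay above [N j], and also above [j], so
    that they tend to infinity. *)
Lemma exists_dominating (N : nat -> nat) :
  exists k : nat -> nat, forall j i, (j <= i)%N -> (j <= k i)%N /\ (N j <= k i)%N.
Proof.
exists (fun i => maxn i (\max_(j < i.+1) N j)) => j i ji.
split; first exact: leq_trans (leq_maxl _ _).
rewrite (leq_trans _ (leq_maxr _ _))//.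
exact: (@leq_bigmax _ (fun j : 'I_i.+1 => N j) (Ordinal (n:=i.+1) (m:=j) ji)).
Qed.

Lemma limn_einf_le (w : (\bar R) ^nat) (e : \bar R) :
  (forall n, w n <= e)%E -> (limn_einf w <= e)%E.
Proof.
move=> we; rewrite limn_einf_lim; apply: lime_le; first exact: is_cvg_einfs.
apply: nearW => n; apply: le_trans (we n).
by apply: ereal_inf_lbound; exists n => //=.
Qed.

Lemma L2_dotE (f g : L2 mu) : (L2_dot f g)%:E = (\int[mu]_x (f x * g x)%:E)%E.
Proof.
rewrite /L2_dot /Rintegral fineK//.
by apply: integrable_fin_num => //; exact: L2_dot_integrable.
Qed.

Lemma L2_sqr_subE (f g : L2 mu) :
  (L2_dot (f - g) (f - g))%:E = (\int[mu]_x ((f x - g x) ^+ 2)%:E)%E.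
Proof.
rewrite L2_dotE; apply: ae_eq_integral => //.
- by apply/measurable_EFinP; apply: measurable_funM; exact: L2_measurable.
- by apply/measurable_EFinP/measurable_funX/measurable_funB; exact: L2_measurable.
near=> x => _; rewrite -expr2; congr (_ ^+ 2)%:E.
rewrite (near (L2D_ae f (- g)) x)//; congr (_ + _).
by rewrite (near (L2N_ae g) x).
Unshelve. all: by end_near. Qed.

(** Riesz-Fischer: a fast subsequence converges almost everywhere, and Fatou's lemma along it turns
    the Cauchy bounds into bounds on the distance to the limit. *)
Theorem L2_complete (u : nat -> L2 mu) :
  (forall e, 0 < e -> exists N, forall m n, (N <= m)%N -> (N <= n)%N ->
    L2_dot (u m - u n) (u m - u n) <= e) ->
  exists l : L2 mu, forall e, 0 < e -> exists N, forall n, (N <= n)%N ->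
    L2_dot (u n - l) (u n - l) <= e.
Proof.
move=> uC.
have mu_ n : measurable_fun setT (u n : T -> R) by exact: L2_measurable.
have /choice[N NP] : forall j, exists N, forall m n, (N <= m)%N -> (N <= n)%N ->
    L2_dot (u m - u n) (u m - u n) <= 8^-1 ^+ j.
  by move=> j; apply: uC; rewrite exprn_gt0// invr_gt0.
have [k kP] := exists_dominating N.
have ucvg : {ae mu, forall x, cvgn (fun j => u (k j) x)}.
  apply: (@ae_cvgn_of_fast (fun j => u (k j))) => // j.
  rewrite -L2_sqr_subE lee_fin NP//.
    by have [] := kP j j.+1 (leqnSn j).
  by have [] := kP j j (leqnn j).
(* An upper limit is measurable and defined everywhere, including where the subsequence diverges. *)
pose f x := fine (limn_esup (fun j => (u (k j) x)%:E)).
have mf : measurable_fun setT f.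
  apply: measurableT_comp => //; apply: measurable_fun_limn_esup => j.
  by apply/measurable_EFinP.
have fE : {ae mu, forall x, u (k j) x @[j --> \oo] --> f x}.
  apply: filterS ucvg => x ux.
  rewrite /f is_cvg_limn_esupE; last first.
    by apply/cvg_ex; have /cvg_ex[l xl] := ux; exists l%:E; apply/cvg_EFin => //; exact: nearW.
  by rewrite EFin_lim.
have fatouf e n M : (forall m, (M <= m)%N -> L2_dot (u n - u m) (u n - u m) <= e) ->
    (\int[mu]_x ((u n x - f x) ^+ 2)%:E <= e%:E)%E.
  move=> ne.
  pose F j x := ((u n x - u (k (j + M)%N) x) ^+ 2)%:E.
  have mF j : measurable_fun setT (F j).
    by apply/measurable_EFinP/measurable_funX/measurable_funB.
  have F0 j x : setT x -> (0 <= F j x)%E by move=> _; rewrite lee_fin sqr_ge0.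
  have -> : (\int[mu]_x ((u n x - f x) ^+ 2)%:E = \int[mu]_x limn_einf (F ^~ x))%E.
    apply: ae_eq_integral => //.
    - by apply/measurable_EFinP/measurable_funX/measurable_funB.
    - rewrite (_ : (fun x => _) = fun x => - limn_esup (fun j => - F j x))%E.
        apply: measurableT_comp => //; apply: measurable_fun_limn_esup => j.
        exact: measurableT_comp.
      by apply/funext => x; rewrite -limn_einfN; congr limn_einf; apply/funext => j; rewrite /comp oppeK.
    apply: filterS fE => x ufx _; apply/esym.
    have Fx : F j x @[j --> \oo] --> ((u n x - f x) ^+ 2)%:E.
      apply/cvg_EFin; first exact: nearW.
      have uMx : u (k (j + M)%N) x @[j --> \oo] --> f x.
        by rewrite (cvg_shiftn M (fun j => u (k j) x)).
      by rewrite expr2; apply: cvgM; apply: cvgB => //; exact: cvg_cst.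
    rewrite is_cvg_limn_einfE; last by apply/cvg_ex; eexists; exact: Fx.
    exact/cvg_lim.
  apply: le_trans (fatou mu measurableT mF F0) _.
  apply: limn_einf_le => j; rewrite -L2_sqr_subE lee_fin; apply: ne.
  by rewrite (leq_trans (leq_addl j M))//; have [] := kP _ _ (leqnn (j + M)%N).
have [M MP] := uC 1 ltr01.
(* Fatou controls only differences with [f], so the limit is built as [u M] minus the class of
   [u M - f]. *)
have [h hE] : exists h : L2 mu, {ae mu, forall x, h x = u M x - f x}.
  apply: L2_of_sqr_lty; first exact: measurable_funB.
  apply: le_lt_trans (ltry 1).
  by apply: (fatouf 1 M M) => m Mm; exact: MP.
pose l : L2 mu := u M - h.
have lf : {ae mu, forall x, l x = f x}.
  near=> x; rewrite (near (L2D_ae (u M) (- h)) x)// (near (L2N_ae h) x)//.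
  by rewrite (near hE x)// opprB subrKC.
exists l => e e0.
have [M' MP'] := uC e e0; exists M' => n Mn.
rewrite -lee_fin L2_sqr_subE.
have -> : (\int[mu]_x ((u n x - l x) ^+ 2)%:E = \int[mu]_x ((u n x - f x) ^+ 2)%:E)%E.
  apply: ae_eq_integral => //.
  - by apply/measurable_EFinP/measurable_funX/measurable_funB => //; exact: L2_measurable.
  - by apply/measurable_EFinP/measurable_funX/measurable_funB.
  by apply: filterS lf => x -> _.
by apply: (fatouf e n M') => m Mm; exact: MP'.
Unshelve. all: by end_near. Qed.

End L2_complete.

Section weighted_complete.
Context d (T : measurableType d) (R : realType).
Variables (mu : {measure set T -> \bar R}) (w0 w1 : {posnum R}).

(** The squared norm dominates the weighted square of each of the three components, so Cauchy
    sequences converge componentwise. *)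
Lemma wL2_hilbert : hilbert (@dot d T R mu w0 w1).
Proof.
split.
- exact: dotC.
- exact: dotDl.
- exact: dotZl.
- by move=> x; rewrite wL2_normE sqr_sqrtr// dot_ge0.
move=> u uC.
have dotE (f : weighted_L2 mu w0 w1) : dot f f =
    L2_dot (inner f) (inner f) + w0%:num * bval0 f ^+ 2 + w1%:num * bval1 f ^+ 2.
  by [].
have dotub (f : weighted_L2 mu w0 w1) :
    [/\ L2_dot (inner f) (inner f) <= `|f| ^+ 2,
        w0%:num * bval0 f ^+ 2 <= `|f| ^+ 2 & w1%:num * bval1 f ^+ 2 <= `|f| ^+ 2].
  rewrite wL2_normE sqr_sqrtr ?dot_ge0// dotE.
  have q := L2_dot_ge0 (inner f).
  have q0 : 0 <= w0%:num * bval0 f ^+ 2 by rewrite mulr_ge0 ?sqr_ge0.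
  have q1 : 0 <= w1%:num * bval1 f ^+ 2 by rewrite mulr_ge0 ?sqr_ge0.
  by split; lra.
have [l lP] : exists l : L2 mu, forall e, 0 < e -> exists N, forall n, (N <= n)%N ->
    L2_dot (inner (u n) - l) (inner (u n) - l) <= e.
  apply: (@L2_complete _ _ _ mu (fun n => inner (u n))) => e e0.
  have se0 : 0 < Num.sqrt e by rewrite sqrtr_gt0.
  have [N NP] := uC _ se0; exists N => m n Nm Nn.
  have [+ _ _] := dotub (u m - u n); move=> /le_trans; apply.
  rewrite -(sqr_sqrtr (ltW e0)) ler_pXn2r ?nnegrE ?sqrtr_ge0//.
  exact: NP.
have bv (b : weighted_L2 mu w0 w1 -> R) (w : {posnum R}) :
    (forall f g, b (f - g) = b f - b g) ->
    (forall f, w%:num * b f ^+ 2 <= `|f| ^+ 2) ->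
    exists l : R, b (u n) @[n --> \oo] --> l.
  move=> bB bw; apply/cvg_ex/cauchy_cvgP/cauchy_exP => e e0.
  have sw0 : 0 < Num.sqrt w%:num by rewrite sqrtr_gt0.
  have de0 : 0 < Num.sqrt w%:num * (e / 2) by rewrite mulr_gt0// divr_gt0.
  have [N NP] := uC _ de0; exists (b (u N)); exists N => // n /= Nn.
  rewrite /ball/= -bB (@le_lt_trans _ _ (e / 2))//; last first.
    by rewrite ltr_pdivrMr// ltr_pMr// ltr1n.
  rewrite -(@ler_pXn2r _ 2)// ?nnegrE ?divr_ge0 ?(ltW e0)//.
  rewrite real_normK ?num_real// -(ler_pM2l (gt0 w)) (le_trans (bw _))//.
  rewrite -{1}(@sqr_sqrtr _ w%:num)// -exprMn ler_pXn2r ?nnegrE ?(ltW de0)//.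
  exact: NP.
have [l0 l0P] : exists l0 : R, bval0 (u n) @[n --> \oo] --> l0.
  by apply: (bv _ w0) => // f; have [] := dotub f.
have [l1 l1P] : exists l1 : R, bval1 (u n) @[n --> \oo] --> l1.
  by apply: (bv _ w1) => // f; have [] := dotub f.
have sq (w c : R) (b : R ^nat) : b @ \oo --> c -> w * (b n - c) ^+ 2 @[n --> \oo] --> 0.
  move=> bc; rewrite -[X in _ --> X](mulr0 w); apply: cvgMr.
  have bc0 : b n - c @[n --> \oo] --> c - c by apply: cvgB => //; exact: cvg_cst.
  have -> : 0 = (c - c) * (c - c) by rewrite subrr mulr0.
  exact: (cvgM bc0 bc0).
exists (WeightedL2 w0 w1 l l0 l1).
apply/cvgrPdist_le => e e0.
have e30 : 0 < e ^+ 2 / 3 by rewrite divr_gt0// exprn_gt0.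
have [N NP] := lP _ e30.
near=> n.
rewrite distrC -(@ler_pXn2r _ 2)// ?nnegrE ?(ltW e0)//.
rewrite wL2_normE sqr_sqrtr ?dot_ge0// dotE.
have -> : e ^+ 2 = e ^+ 2 / 3 + e ^+ 2 / 3 + e ^+ 2 / 3 by field.
rewrite lerD// ?lerD//.
- by apply: NP; near: n; exists N.
- rewrite (le_trans (ler_norm _))//; near: n.
  have /cvgrPdist_le/(_ _ e30) := sq w0%:num _ _ l0P.
  by apply: filterS => n; rewrite sub0r normrN.
- rewrite (le_trans (ler_norm _))//; near: n.
  have /cvgrPdist_le/(_ _ e30) := sq w1%:num _ _ l1P.
  by apply: filterS => n; rewrite sub0r normrN.
Unshelve. all: by end_near. Qed.

End weighted_complete.

(** * Primitives and weak derivatives on the unit interval *)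

(* Instance resolution does not find [ae_filter_ringOfSetsType] when the points
   have type [R]. *)
#[local] Instance ae_leb01_filter (R : realType) :
  Filter (nbhs (almost_everywhere (leb01 R))).
Proof. exact: ae_filter_ringOfSetsType. Qed.

#[local] Instance ae_lebesgue_filter (R : realType) :
  Filter (nbhs (almost_everywhere (@lebesgue_measure R))).
Proof. exact: ae_filter_ringOfSetsType. Qed.

Section primitive.
Context {R : realType}.
Notation mu := (@lebesgue_measure R).
Local Notation I01 := (`]0%R, 1%R[%classic : set R).
Implicit Types (f g : R -> R) (x y s t : R).

Definition integrable01 f := mu.-integrable I01 (EFin \o f).

(** The interval is open so that [prim f 1] is by definition the integral over []0, 1[]. *)
Definition prim f x : R := \int[mu]_(t in `]0, x[) f t.

Lemma prim0 f : prim f 0 = 0.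
Proof. by rewrite /prim set_itv_ge ?bnd_simp ?ltxx// Rintegral_set0. Qed.

Lemma subset_I01 s t : 0 <= s -> t <= 1 -> `]s, t[ `<=` I01.
Proof.
by move=> s0 t1; apply: subset_itv; rewrite bnd_simp.
Qed.

Lemma integrable01S f s t : 0 <= s -> t <= 1 -> integrable01 f ->
  mu.-integrable `]s, t[ (EFin \o f).
Proof. by move=> s0 t1 fi; apply: integrableS fi => //; exact: subset_I01. Qed.

Lemma prim_sub f s t : integrable01 f -> 0 <= s -> s <= t -> t <= 1 ->
  prim f t - prim f s = \int[mu]_(x in `]s, t[) f x.
Proof.
move=> fi s0; rewrite le_eqVlt => /predU1P[<- _|st t1].
  by rewrite subrr set_itv_ge ?bnd_simp ?ltxx// Rintegral_set0.
have := @Rintegral_itvB R f (BRight 0) (BLeft t) s.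
rewrite !bnd_simp => /(_ (integrable01S (lexx 0) t1 fi) s0 st) <-.
by rewrite -Rintegral_itv_bndo_bndc//; apply: integrable01S => //; lra.
Qed.

Lemma prim_dist f s t : integrable01 f -> 0 <= s -> s <= t -> t <= 1 ->
  `|prim f t - prim f s| <= \int[mu]_(x in `]s, t[) `|f x|.
Proof.
move=> fi s0 st t1; rewrite prim_sub//.
by apply: le_normr_Rintegral => //; exact: integrable01S.
Qed.

Lemma integrable01_restrict f : integrable01 f ->
  mu.-integrable setT (EFin \o (f \_ I01)).
Proof.
by move=> fi; rewrite -restrict_EFin; apply/integrable_restrict => //; rewrite setTI.
Qed.

(** Absolute continuity of the integral, applied to the union of the disjoint intervals, whose
    measure is below [d]. *)
Lemma prim_abs_continuous f : integrable01 f -> absolutely_continuous 0 1 (prim f).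
Proof.
move=> fi e e0.
have [d [d0 dP]] := integral_normr_continuous (integrable01_restrict fi) e0.
exists d => // n s t st triv std.
pose D := \bigcup_(i in [set` index_enum 'I_n]) `]s i, t i[%classic.
have mitv i : measurable `]s i, t i[%classic by [].
have DE : D = \big[setU/set0]_(i < n) `]s i, t i[%classic.
  by rewrite /D -bigcup_seq.
have mD : measurable D by rewrite DE; exact: bigsetU_measurable.
have muD : (mu D < d%:E)%E.
  rewrite DE measure_bigsetU_ord//.
  rewrite (eq_bigr (fun i => (t i - s i)%:E)); first by rewrite sumEFin lte_fin.
  move=> i _; have [_ [sti _]] := st i.
  rewrite [LHS](_ : _ = mu `]s i, t i[%classic)// lebesgue_measure_itv/= lte_fin.
  move: sti; rewrite le_eqVlt => /predU1P[->|->//].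
  by rewrite ltxx subrr.
have ifD : (\int[mu]_(x in D) `|(f \_ I01) x|%:E)%E \is a fin_num.
  apply: integrable_fin_num => //; apply: (@integrableS _ _ _ mu setT) => //.
  exact/integrable_norm/integrable01_restrict.
apply: le_lt_trans (dP D mD muD).
rewrite -lee_fin /Rintegral fineK// -sumEFin DE ge0_integral_bigsetU//; first last.
- by apply/measurable_EFinP/measurableT_comp => //; apply: measurable_funTS;
    apply/measurable_EFinP; have /integrableP[] := integrable01_restrict fi.
- exact: sub_trivIset triv.
- exact: index_enum_uniq.
apply: lee_sum => i _; have [s0 [sti t1]] := st i.
have ifi : mu.-integrable `]s i, t i[ (EFin \o f) by exact: integrable01S.
apply: (@le_trans _ _ (\int[mu]_(x in `]s i, t i[) `|f x|)%:E).
  by rewrite lee_fin prim_dist.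
rewrite /Rintegral fineK; last first.
  exact/(integrable_fin_num _ (integrable_norm ifi)).
rewrite le_eqVlt; apply/orP; left; apply/eqP/eq_integral => x.
rewrite inE/= => xi; rewrite patchE mem_set//; exact: subset_I01 xi.
Qed.

Lemma abs_continuous_within f : absolutely_continuous 0 1 f ->
  {within `[0, 1], continuous f}.
Proof.
move=> acf; apply/subspace_continuousP => x x01.
apply/cvgrPdist_lt => e e0.
have [d d0 dP] := acf e e0.
have key s t : 0 <= s -> s <= t -> t <= 1 -> t - s < d -> `|f t - f s| < e.
  move=> s0 st t1 std.
  have := dP 1%N (fun=> s) (fun=> t); rewrite !big_ord1; apply => //.
  by move=> i j _ _ _; rewrite !ord1.
rewrite near_withinE; near=> y => y01.
have yx : `|x - y| < d by near: y; exact: cvgr_dist_lt.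
move: x01 y01 yx => /=; rewrite !in_itv/= => /andP[x0 x1] /andP[y0 y1].
move=> xyd; change (`|f x - f y| < e); have [xy|yx] := leP x y.
  rewrite distrC; apply: key => //.
  by rewrite -(ger0_norm (_ : 0 <= y - x)) ?subr_ge0// distrC.
by apply: key => //; [exact: ltW|rewrite -(ger0_norm (_ : 0 <= x - y)) ?subr_ge0// ltW].
Unshelve. all: by end_near. Qed.

Lemma prim_within_continuous f : integrable01 f ->
  {within `[0, 1], continuous (prim f)}.
Proof. by move=> fi; exact/abs_continuous_within/prim_abs_continuous. Qed.

(** * Integrability on the unit interval and integration by parts *)

Lemma prim_indic f x : integrable01 f -> 0 <= x <= 1 ->
  (prim f x)%:E = (\int[mu]_y ((f \_ I01) y * (y < x)%R%:R)%:E)%E.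
Proof.
move=> fi /andP[x0 x1]; rewrite /prim /Rintegral fineK; last first.
  by apply: integrable_fin_num => //; exact: integrable01S.
rewrite integral_mkcond; apply: eq_integral => y _; rewrite !patchE.
rewrite !mem_setE !in_itv/=.
have [yx|xy] := ltP y x; last by rewrite andbF mulr0.
by rewrite andbT mulr1 (lt_le_trans yx x1) andbT; case: ifP.
Qed.

Lemma within_measurable01 g : {within `[0, 1], continuous g} -> measurable_fun I01 g.
Proof.
move=> cg; apply: (measurable_funS _ (_ : I01 `<=` `[0, 1])) => //.
  by apply: subset_itv; rewrite bnd_simp.
exact: subspace_continuous_measurable_fun.
Qed.

Lemma within_bounded01 g : {within `[0, 1], continuous g} ->
  exists2 M : R, 0 < M & forall x, 0 <= x <= 1 -> `|g x| <= M.
Proof.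
move=> cg; have /compact_bounded[M [_ MP]] : compact (g @` `[0, 1]).
  by apply: continuous_compact => //; exact: segment_compact.
exists (`|M| + 1); first by rewrite ltr_wpDl.
move=> x x01; apply: MP; first by rewrite (le_lt_trans (ler_norm _))// ltrDl.
by exists x => //=; rewrite in_itv.
Qed.

Lemma integrable01_mul_cont f g : integrable01 f ->
  {within `[0, 1], continuous g} -> integrable01 (fun x => f x * g x).
Proof.
move=> fi cg; have [M M0 MP] := within_bounded01 cg.
rewrite /integrable01 (_ : _ \o _ = (EFin \o g) \* (EFin \o f))%E; last first.
  by apply/funext => x /=; rewrite mulrC.
apply: integrableMr => //; first exact: within_measurable01.
exists M; split; first exact: num_real.
move=> B MB x /=; rewrite in_itv/= => /andP[x0 x1].
by rewrite (le_trans (MP _ _)) ?(ltW MB)// !ltW.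
Qed.

Lemma integrable01_cont_mul f g : integrable01 f ->
  {within `[0, 1], continuous g} -> integrable01 (fun x => g x * f x).
Proof.
move=> fi cg; have := integrable01_mul_cont fi cg.
by rewrite (_ : (fun x => f x * g x) = fun x => g x * f x)//; apply/funext => x; rewrite mulrC.
Qed.

Lemma within_integrable01 g : {within `[0, 1], continuous g} -> integrable01 g.
Proof.
move=> cg; have i1 : integrable01 (cst 1).
  apply/integrableP; split; first by apply/measurable_EFinP; exact: measurable_cst.
  under eq_integral do rewrite /= normr1.
  by rewrite integral_cst//= mul1e lebesgue_measure_itv/= lte_fin ltr01 -EFinB ltry.
have := integrable01_mul_cont i1 cg.
by rewrite /integrable01 (_ : (fun x => _) = g)//; apply/funext => x; rewrite /= mul1r.
Qed.

Lemma prim_indicr f x : integrable01 f -> 0 <= x <= 1 ->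
  (prim f 1 - prim f x)%:E = (\int[mu]_y ((f \_ I01) y * (x < y)%R%:R)%:E)%E.
Proof.
move=> fi /andP[x0 x1]; rewrite prim_sub// /Rintegral fineK; last first.
  by apply: integrable_fin_num => //; exact: integrable01S.
rewrite integral_mkcond; apply: eq_integral => y _; rewrite !patchE.
rewrite !mem_setE !in_itv/=.
have [xy|yx] := ltP x y; last by rewrite mulr0.
by rewrite mulr1 (le_lt_trans x0 xy); case: ifP.
Qed.

Lemma measurable_restrict01 f : integrable01 f -> measurable_fun setT (f \_ I01).
Proof.
by move=> /integrable01_restrict/integrableP[? _]; exact/measurable_EFinP.
Qed.

Lemma measurable_boolr d (T : measurableType d) (b : T -> bool) :
  measurable_fun setT b -> measurable_fun setT (fun z => (b z)%:R : R).
Proof.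
move=> mb; rewrite (_ : (fun z => _) = fun z => if b z then 1 else 0 : R).
  exact: measurable_fun_ifT.
by apply/funext => z; case: ifP.
Qed.

Lemma integrable_restrict_bool f (b : R -> bool) : integrable01 f ->
  measurable_fun setT b ->
  mu.-integrable setT (fun y => ((f \_ I01) y * (b y)%:R)%:E).
Proof.
move=> fi mb; apply: le_integrable (integrable01_restrict fi) => //.
  apply/measurable_EFinP; apply: measurable_funM (measurable_restrict01 fi) _.
  exact: measurable_boolr.
move=> y _; rewrite lee_fin normrM.
by case: (b y); rewrite ?normr1 ?normr0 ?mulr1// mulr0.
Qed.

Lemma integrable01_restrict_mul f g : integrable01 f -> integrable01 g ->
  (mu \x mu)%E.-integrable setT (fun z : R * R => ((f \_ I01) z.1 * (g \_ I01) z.2)%:E).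
Proof.
move=> fi gi; pose F := f \_ I01; pose G := g \_ I01.
have /integrableP[mF Foo] := integrable01_restrict fi.
have /integrableP[mG Goo] := integrable01_restrict gi.
have rF : measurable_fun setT F by apply/measurable_EFinP.
have rG : measurable_fun setT G by apply/measurable_EFinP.
apply/integrable12ltyP.
  apply/measurable_EFinP; apply: measurable_funM.
    by apply: (measurableT_comp rF); exact: measurable_fst.
  by apply: (measurableT_comp rG); exact: measurable_snd.
pose c : \bar R := (\int[mu]_y `|(G y)%:E|)%E.
have c0 : (0 <= c)%E by exact: integral_ge0.
have cfin : c \is a fin_num by rewrite ge0_fin_numE.
under eq_integral => x _.
  under eq_integral => y _ do rewrite /= normrM EFinM.
  rewrite ge0_integralZl//; last by apply/measurable_EFinP; exact: measurableT_comp.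
  over.
rewrite /= ge0_integralZr//; last by apply/measurable_EFinP; exact: measurableT_comp.
by rewrite lte_mul_pinfty// ?integral_ge0// ge0_fin_numE// integral_ge0.
Qed.

(** Fubini for [f x * g y] on the triangle [y < x]: one inner integral gives [prim g x], the other
    [prim f 1 - prim f y]. *)
Lemma prim_by_parts f g : integrable01 f -> integrable01 g ->
  \int[mu]_(x in I01) (f x * prim g x) + \int[mu]_(x in I01) (g x * prim f x) =
  prim f 1 * prim g 1.
Proof.
move=> fi gi.
have cf := prim_within_continuous fi; have cg := prim_within_continuous gi.
pose F := f \_ I01; pose G := g \_ I01.
have mF := measurable_restrict01 fi; have mG := measurable_restrict01 gi.
pose K (z : R * R) : \bar R := (F z.1 * G z.2 * (z.2 < z.1)%R%:R)%:E.
have Ki : (mu \x mu)%E.-integrable setT K.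
  apply: le_integrable (integrable01_restrict_mul fi gi) => //.
    apply/measurable_EFinP; apply: measurable_funM.
      apply: measurable_funM.
        by apply: (measurableT_comp mF); exact: measurable_fst.
      by apply: (measurableT_comp mG); exact: measurable_snd.
    apply: measurable_boolr.
    exact: (measurable_fun_ltr measurable_snd measurable_fst).
  move=> z _; rewrite /K lee_fin !normrM.
  by case: (z.2 < z.1); rewrite ?normr1 ?normr0 ?mulr1// mulr0 mulr_ge0.
have KE := Fubini Ki.
have K1 : (\int[mu]_x \int[mu]_y K (x, y) = (\int[mu]_(x in I01) (f x * prim g x))%:E)%E.
  rewrite /Rintegral fineK; last first.
    by apply: integrable_fin_num => //; exact: integrable01_mul_cont.
  rewrite [RHS]integral_mkcond; apply: eq_integral => x _; rewrite patchE.
  case: ifPn => xI; last first.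
    under eq_integral => y _ do rewrite /K/= /F patchE (negbTE xI) !mul0r.
    exact: integral0.
  move: (xI); rewrite inE/= in_itv/= => /andP[x0 x1].
  rewrite EFinM prim_indic ?ltW//.
  under eq_integral => y _ do rewrite /K/= /F patchE xI -mulrA EFinM.
  apply: integralZl; first exact: measurableT.
  apply: integrable_restrict_bool; [by []|exact: measurable_fun_ltr].
have cfB : {within `[0, 1], continuous (fun x => prim f 1 - prim f x)}.
  by move=> x; apply: cvgB; [exact: cvg_cst|exact: cf].
have K2 : (\int[mu]_y \int[mu]_x K (x, y) = (\int[mu]_(y in I01) (g y * (prim f 1 - prim f y)))%:E)%E.
  rewrite /Rintegral fineK; last first.
    by apply: integrable_fin_num => //; exact: integrable01_mul_cont.
  rewrite [RHS]integral_mkcond; apply: eq_integral => y _; rewrite patchE.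
  case: ifPn => yI; last first.
    under eq_integral => x _ do rewrite /K/= /G patchE (negbTE yI) mulr0 mul0r.
    exact: integral0.
  move: (yI); rewrite inE/= in_itv/= => /andP[y0 y1].
  rewrite EFinM prim_indicr ?ltW//.
  under eq_integral => x _ do rewrite /K/= /G patchE yI (mulrC (F x)) -mulrA EFinM.
  apply: integralZl; first exact: measurableT.
  apply: integrable_restrict_bool; [by []|exact: measurable_fun_ltr].
move: KE; rewrite K1 K2 => -[->].
rewrite -RintegralD//=; last 2 first.
  exact: integrable01_mul_cont.
  exact: integrable01_mul_cont.
under eq_Rintegral do rewrite -mulrDr subrK.
by rewrite RintegralZr// mulrC.
Qed.

(** Membership in [W^{1,1}(0,1)] in integral form, [f] being the absolutely continuous
    representative on [[0, 1]]. Boundary values and integration by parts are direct in this form, so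
    [H1] and [H2a] are translated to it. *)
Record primitive f f' : Prop := {
  primitive_int : integrable01 f' ;
  primitiveE : forall x, 0 <= x <= 1 -> f x = f 0 + prim f' x }.

Lemma primitive_ac f f' : primitive f f' -> absolutely_continuous 0 1 f.
Proof.
move=> [f'i fE] e e0; have [d d0 dP] := prim_abs_continuous f'i e0.
exists d => // n s t st triv std; apply: le_lt_trans (dP n s t st triv std).
apply: ler_sum => i _; have [s0 [sti t1]] := st i.
rewrite fE; last by rewrite t1 (le_trans s0).
rewrite (fE (s i)); last by rewrite s0 (le_trans sti).
by rewrite opprD addrACA subrr add0r.
Qed.

Lemma primitive_cont f f' : primitive f f' -> {within `[0, 1], continuous f}.
Proof. by move=> /primitive_ac/abs_continuous_within. Qed.

Lemma primitive_prim c f : integrable01 f -> primitive (fun x => c + prim f x) f.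
Proof. by move=> fi; split => // x _; rewrite prim0 addr0. Qed.

Lemma eq_Rintegral01 f g : (forall x, 0 < x < 1 -> f x = g x) ->
  \int[mu]_(x in I01) f x = \int[mu]_(x in I01) g x.
Proof. by move=> fg; apply: eq_Rintegral => x; rewrite inE/= in_itv/= => /fg. Qed.

Lemma prim1 f : prim f 1 = \int[mu]_(x in I01) f x.
Proof. by []. Qed.

Lemma primitive_by_parts f f' g g' : primitive f f' -> primitive g g' ->
  \int[mu]_(x in I01) (f' x * g x) + \int[mu]_(x in I01) (f x * g' x) =
  f 1 * g 1 - f 0 * g 0.
Proof.
move=> [f'i fE] [g'i gE].
have cf := prim_within_continuous f'i; have cg := prim_within_continuous g'i.
have e1 : \int[mu]_(x in I01) (f' x * g x) =
    \int[mu]_(x in I01) (f' x * g 0 + f' x * prim g' x).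
  by apply: eq_Rintegral01 => x /andP[x0 x1]; rewrite gE ?mulrDr// !ltW.
have e2 : \int[mu]_(x in I01) (f x * g' x) =
    \int[mu]_(x in I01) (g' x * f 0 + g' x * prim f' x).
  by apply: eq_Rintegral01 => x /andP[x0 x1]; rewrite mulrC fE ?mulrDr// !ltW.
have ic (h : R -> R) c : integrable01 h -> integrable01 (fun x => h x * c).
  by move=> hi; apply: integrable01_mul_cont => // x; exact: cvg_cst.
rewrite e1 e2 !RintegralD//=; try exact: ic; try exact: integrable01_mul_cont.
rewrite !RintegralZr// -(prim1 f') -(prim1 g') (fE 1) ?ler01 ?lexx// (gE 1) ?ler01 ?lexx//.
have := prim_by_parts f'i g'i.
move: (\int[mu]_(x in _) _) (\int[mu]_(x in _) _) => A B e.
rewrite addrACA e; ring.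
Qed.

(** If [f] and [g] differed at [x], they would differ on an interval of positive length with [x] as
    an end point. *)
Lemma ae_eq_within f g : {within `[0, 1], continuous f} ->
  {within `[0, 1], continuous g} ->
  {ae mu, forall x, I01 x -> f x = g x} -> forall x, 0 <= x <= 1 -> f x = g x.
Proof.
move=> cf cg fg x x01; apply/eqP/negP => /negP fgx.
have fgx0 : 0 < `|f x - g x| by rewrite normr_gt0 subr_eq0.
have cd : {within `[0, 1], continuous (fun x => f x - g x)}.
  by move=> y; apply: cvgB; [exact: cf|exact: cg].
have x01' : `[0, 1]%classic x by rewrite /= in_itv.
have /subspace_continuousP/(_ x x01')/cvgrPdist_lt/(_ _ fgx0) := cd.
rewrite near_withinE => -[d /= d0 dP].
have [s [t [s0 st t1 stP]]] : exists s t, [/\ 0 <= s, s < t, t <= 1 &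
    forall y, s < y < t -> `|x - y| < d].
  have /andP[x0 x1] := x01.
  (* The interval goes to the right of [x] if [x <= 1 / 2] and to the left otherwise, so a length of
     at most [1 / 4] keeps it inside [[0, 1]]. *)
  pose h := Num.min (d / 2) (1 / 4).
  have h0 : 0 < h by rewrite lt_min !divr_gt0.
  have hd : h < d by rewrite gt_min ltr_pdivrMr// ltr_pMr// ltr1n.
  have h4 : h <= 1 / 4 by rewrite ge_min lexx orbT.
  have [xh|xh] := leP x (1 / 2).
    exists x, (x + h); split; [by []|lra|lra|].
    by move=> y /andP[xy yh]; rewrite distrC gtr0_norm; lra.
  exists (x - h), x; split; [lra|lra|by []|].
  by move=> y /andP[xy yh]; rewrite gtr0_norm; lra.
have stfg : {ae mu, forall y, ~ `]s, t[%classic y}.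
  apply: filterS fg.
  move=> y fgy yst.
  have yI : I01 y by apply: subset_I01 yst.
  have yst' : s < y < t by move: yst; rewrite /= in_itv.
  have y01 : `[0, 1]%classic y.
    by move: yI; rewrite /= !in_itv/= => /andP[/ltW-> /ltW->].
  have := dP y (stP y yst') y01.
  by change (`|f x - g x - (f y - g y)| < `|f x - g x| -> False); rewrite fgy// subrr subr0 ltxx.
have : mu `]s, t[%classic = 0%E.
  have [N [mN N0 sub]] := stfg.
  apply/eqP; rewrite eq_le measure_ge0 andbT -N0 le_measure ?inE//.
  by apply: subset_trans sub => y yst /=; exact.
by rewrite lebesgue_measure_itv/= lte_fin st -EFinB => -[/eqP]; rewrite subr_eq0 gt_eqF.
Qed.

(** Lebesgue differentiation: almost everywhere [f'] is the derivative of [prim f'], which vanishes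
    on [[0, 1]]. *)
Lemma primitive0_ae f f' : primitive f f' -> (forall x, 0 <= x <= 1 -> f x = 0) ->
  {ae mu, forall x, I01 x -> f' x = 0}.
Proof.
move=> [f'i fE] f0.
have p0 x : 0 <= x <= 1 -> prim f' x = 0.
  by move=> x01; have := fE _ x01; rewrite !f0 ?lexx ?ler01// add0r.
pose F := f' \_ I01.
have Fi := integrable01_restrict f'i.
have FNy : forall y, mu.-integrable `]-oo, y] (EFin \o F).
  by move=> y; apply: integrableS Fi.
have locF : locally_integrable setT F by exact: integrable_locally.
have := FTC1Ny FNy locF; apply: filterS.
move=> x [_ Fx] xI.
have : F x = 0.
  rewrite -Fx derive1E (@near_eq_derive _ _ _ _ (cst 0)) ?derive_cst ?oner_eq0//.
  have : \forall y \near x, I01 y by exact: open_nbhs_nbhs.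
  apply: filterS => y; rewrite /= in_itv/= => /andP[y0 y1].
  rewrite -[RHS](p0 y) ?(ltW y0) ?(ltW y1)// /F -Rintegral_mkcondr.
  have -> : `]-oo, y] `&` I01 = `]0, y]%classic.
    apply/seteqP; split => z /=; rewrite !in_itv/=.
      by move=> [-> /andP[->]].
    by move=> /andP[z0 zy]; rewrite z0 zy (le_lt_trans zy).
  by rewrite /prim -Rintegral_itv_bndo_bndc//; apply: integrable01S => //; exact: ltW.
by rewrite /F patchE mem_set.
Qed.

Lemma integrable01D f g : integrable01 f -> integrable01 g ->
  integrable01 (fun x => f x + g x).
Proof.
move=> fi gi; rewrite /integrable01 (_ : EFin \o _ = (EFin \o f) \+ (EFin \o g))%E//.
exact: integrableD.
Qed.

Lemma square_integrable_integrable01 f : square_integrable f -> integrable01 f.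
Proof.
move=> [mf f2i].
have i1 : integrable01 (cst 1) by apply: within_integrable01 => x; exact: cvg_cst.
have i12 : integrable01 (fun x => 1 + f x ^+ 2) by exact: (integrable01D i1).
apply: le_integrable i12 => //; first exact/measurable_EFinP.
move=> x _ /=; rewrite lee_fin (ger0_norm (addr_ge0 ler01 (sqr_ge0 _))).
by rewrite -(real_normK (num_real (f x))); have := sqr_ge0 (`|f x| - 1); nra.
Qed.

Lemma within_square_integrable f : {within `[0, 1], continuous f} -> square_integrable f.
Proof.
move=> cf; split; first exact: within_measurable01.
by have := integrable01_mul_cont (within_integrable01 cf) cf.
Qed.

(** * Test functions and weak derivatives *)

Lemma integrable01_locally f : integrable01 f -> locally_integrable I01 f.
Proof. by move=> fi; apply: open_integrable_locally => //; exact: interval_open. Qed.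

Lemma test_function_primitive phi : test_function phi ->
  [/\ primitive phi (derive1 phi), phi 0 = 0 & phi 1 = 0].
Proof.
move=> [dphi cphi [c [d [c0 d1 cd]]]].
have phi0 : phi 0 = 0 by apply: cd; rewrite in_itv/= (leNgt c) c0.
have phi1 : phi 1 = 0 by apply: cd; rewrite in_itv/= (leNgt _ d) d1 andbF.
have wc a b : {within `[a, b], continuous (derive1 phi)}.
  by apply: continuous_subspaceT => x; exact: cphi.
have phi'i := within_integrable01 (wc 0 1).
split=> //; split; first exact: phi'i.
move=> x /andP[]; rewrite le_eqVlt => /predU1P[<- _|x0 x1].
  by rewrite prim0 addr0.
have cphi0 y : {for y, continuous phi}.
  by apply: differentiable_continuous; apply/derivable1_diffP.
have := @continuous_FTC2 _ (derive1 phi) phi 0 x x0 (wc _ _).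
rewrite phi0 => FTC; rewrite add0r.
apply: EFin_inj; rewrite -[LHS]sube0 -FTC//; last first.
  split; first by move=> y _; exact: dphi.
    by apply: cvg_at_right_filter; exact: cphi0.
  by apply: cvg_at_left_filter; exact: cphi0.
rewrite -integral_itv_obnd_cbnd -?integral_itv_bndo_bndc.
- rewrite /prim /Rintegral fineK//; apply: integrable_fin_num => //.
  exact: (integrable01S (lexx 0) x1 phi'i).
all: by apply: measurable_funTS; apply/measurable_EFinP; exact: continuous_measurable_fun.
Qed.

Lemma weak_derivative_of_primitive f f' : primitive f f' -> weak_derivative f f'.
Proof.
move=> ff'; split.
- exact/integrable01_locally/within_integrable01/primitive_cont/ff'.
- by apply: integrable01_locally; have [] := ff'.
move=> phi /test_function_primitive[pphi phi0 phi1].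
have := primitive_by_parts ff' pphi.
rewrite phi0 phi1 !mulr0 subrr addrC => /eqP; rewrite addr_eq0 => /eqP.
exact.
Qed.

Lemma H1_of_primitive f f' : primitive f f' -> square_integrable f' -> H1 f f'.
Proof.
move=> ff' f'2; have cf := primitive_cont ff'; split => //.
- exact: within_square_integrable.
- exact: weak_derivative_of_primitive.
Qed.

Lemma within_continuous_itv f x : {within `[0, 1], continuous f} -> 0 < x < 1 ->
  {for x, continuous f}.
Proof.
move=> /(continuous_within_itvP _ ltr01)[cf _ _] x01.
by apply: cf; rewrite in_itv.
Qed.

Lemma Rintegral0_within g : {within `[0, 1], continuous g} ->
  \int[mu]_(x in I01) g x = 0 -> (forall x, 0 < x < 1 -> 0 <= g x) ->
  forall x, 0 <= x <= 1 -> g x = 0.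
Proof.
move=> cg g0 gge0; have gi := within_integrable01 cg.
have gE : (\int[mu]_(x in I01) `|(g x)%:E| = 0)%E.
  transitivity (\int[mu]_(x in I01) (g x)%:E)%E.
    by apply: eq_integral => x; rewrite inE/= in_itv/= => /gge0 ?; rewrite ger0_norm.
  by rewrite -[LHS]fineK ?integrable_fin_num//; congr EFin.
apply: (ae_eq_within cg); first by move=> x; exact: cvg_cst.
have mI : measurable I01 by [].
have /integrableP[mg _] := gi.
have := (ae_eq_integral_abs mu mI mg).1 gE.
apply: filterS.
by move=> x + xI => /(_ xI) [].
Qed.

(* du Bois-Reymond: test against the [phi] with [phi' = w (h - c)], where [w] is
   a cutoff function and [c] makes the mean of [phi'] vanish. *)
Lemma weak_derivative0_const (h : R -> R) : {within `[0, 1], continuous h} ->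
  (forall phi, test_function phi -> \int[mu]_(x in I01) (h x * derive1 phi x) = 0) ->
  forall x, 0 <= x <= 1 -> h x = h 0.
Proof.
move=> ch hphi.
(* A product of positive parts: continuous, nonnegative, and positive exactly on []d, 1 - d[]. *)
pose w d x : R := Num.max 0 (x - d) * Num.max 0 (1 - d - x).
have w_gt0 d x : d < x < 1 - d -> 0 < w d x.
  move=> /andP[dx xd]; rewrite /w.
  by rewrite mulr_gt0// lt_max ?subr_gt0 ?dx ?xd orbT.
have w_out d x : x \notin `[d, 1 - d] -> w d x = 0.
  rewrite in_itv/= negb_and -!ltNge /w => /orP[xd|dx].
    by rewrite (max_l (_ : x - d <= 0)) ?mul0r// subr_le0 ltW.
  by rewrite mulrC (max_l (_ : 1 - d - x <= 0)) ?mul0r// subr_le0 ltW.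
have w_ge0 d x : 0 <= w d x by rewrite mulr_ge0// le_max lexx.
have cw d : continuous (w d).
  move=> x; apply: cvgM.
    apply: (@continuous_max _ _ (cst 0) (fun y => y - d)); first exact: cvg_cst.
    by apply: cvgB => //; exact: cvg_cst.
  apply: (@continuous_max _ _ (cst 0) (fun y => 1 - d - y)); first exact: cvg_cst.
  by apply: cvgB => //; exact: cvg_cst.
have loc d : 0 < d -> d < 1 / 2 -> exists c, forall x, d < x < 1 - d -> h x = c.
  move=> d0 d2.
  have cwd : {within `[0, 1], continuous (w d)} by exact: continuous_subspaceT.
  have wh c : {within `[0, 1], continuous (fun x => w d x * (h x - c))}.
    move=> x; apply: cvgM; first exact: cwd.
    by apply: cvgB; [exact: ch|exact: cvg_cst].
  pose W := \int[mu]_(x in I01) w d x.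
  (* The mean of [h] with weight [w d]: it gives [q] integral 0, so that the primitive of [q]
     vanishes to the right of [1 - d] as well. *)
  pose c := (\int[mu]_(x in I01) (w d x * h x)) / W.
  pose q x := w d x * (h x - c).
  have q0 x : x \notin `[d, 1 - d] -> q x = 0 by move=> /w_out; rewrite /q => ->; rewrite mul0r.
  have cq : continuous q.
    move=> x; have [x01|x01] := boolP (0 < x < 1).
      apply: cvgM; first exact: cw.
      by apply: cvgB; [exact: within_continuous_itv|exact: cvg_cst].
    have qx0 : q x = 0.
      apply: q0; apply: contra x01; rewrite in_itv/= => /andP[dx xd].
      by apply/andP; split; lra.
    have out y : q x = 0 -> (y < d) || (1 - d < y) -> q y = q x.
      move=> ->; rewrite orbC => yd; apply: q0.
      by rewrite in_itv/= negb_and -!ltNge orbC.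
    rewrite /prop_for /continuous_at; apply: cvg_near_cst.
    have [x0|x0] := leP x 0.
      have : \forall y \near x, `]-oo, d[%classic y.
        by apply: open_nbhs_nbhs; split => //=; rewrite in_itv/= (le_lt_trans x0).
      by apply: filterS => y; rewrite /= in_itv/= => yd; apply: out; rewrite ?yd.
    have x1 : 1 <= x by move: x01; rewrite x0/= -leNgt.
    have : \forall y \near x, `]1 - d, +oo[%classic y.
      apply: open_nbhs_nbhs; split => //=; rewrite in_itv/= andbT.
      by rewrite (lt_le_trans _ x1)// gtrBl.
    by apply: filterS => y; rewrite /= in_itv/= andbT => yd; apply: out; rewrite ?yd ?orbT.
  have iq := within_integrable01 (wh c : {within `[0, 1], continuous q}).
  pose hf : R := 1 / 2.
  have half : 0 <= hf <= 1 by rewrite /hf; apply/andP; split; lra.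
  have W0 : W != 0.
    apply/eqP => /(Rintegral0_within cwd) => /(_ (fun x _ => w_ge0 d x)).
    move=> /(_ _ half); apply/eqP; rewrite gt_eqF// w_gt0//.
    by rewrite /hf; apply/andP; split; lra.
  have iw := within_integrable01 cwd.
  have iwh : integrable01 (fun x => w d x * h x) by exact: integrable01_mul_cont.
  have ic (g : R -> R) (b : R) : integrable01 g -> integrable01 (fun x => g x * b).
    by move=> gi; apply: integrable01_mul_cont => // x; exact: cvg_cst.
  have Iq : \int[mu]_(x in I01) q x = 0.
    under eq_Rintegral do rewrite /q mulrBr.
    rewrite RintegralB//=; last exact: ic.
    by rewrite RintegralZr// /c mulrC -/W divrK ?subrr// unitfE.
  pose phi x := \int[mu]_(t in `]-oo, x]) q t.
  have qI : q = q \_ I01.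
    apply/funext => x; rewrite patchE; case: ifPn => // xI; apply: q0.
    apply: contra xI; rewrite inE/= !in_itv/= => /andP[dx xd].
    by apply/andP; split; lra.
  have qT : mu.-integrable setT (EFin \o q) by rewrite qI; exact: integrable01_restrict.
  have dphi x : derivable phi x 1 /\ derive1 phi x = q x.
    apply: (@continuous_FTC1 _ q -oo%O x (x + 1)) => //.
    - by rewrite ltrDl.
    - exact: integrableS qT.
    - by rewrite ltNyr.
    - exact: cq.
  have phi'E : derive1 phi = q by apply/funext => x; have [] := dphi x.
  have tphi : test_function phi.
    split; first by move=> x; have [] := dphi x.
      by rewrite phi'E.
    exists d, (1 - d); split => //; first by rewrite gtrBl.
    move=> x; rewrite in_itv/= negb_and -!ltNge => /orP[xd|dx].
      transitivity (\int[mu]_(t in `]-oo, x]) (0 : R)); last by rewrite Rintegral_cst// mul0r.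
      apply: eq_Rintegral => y; rewrite inE/= in_itv/= => yx; apply: q0.
      by rewrite in_itv/= negb_and -!ltNge (le_lt_trans yx xd).
    rewrite -Iq /phi [RHS]Rintegral_mkcond [LHS]Rintegral_mkcond.
    apply: eq_Rintegral => y _; transitivity (q y); last first.
      by rewrite [LHS](congr1 (fun g => g y) qI).
    rewrite patchE mem_setE in_itv/=.
    case: leP => // xy; apply/esym/q0.
    by rewrite in_itv/= negb_and -!ltNge (lt_trans dx xy) orbT.
  (* Testing against the primitive of [q] gives [int h q = 0]; subtracting [c int q = 0] produces
     the square. *)
  have hq : \int[mu]_(x in I01) (w d x * (h x - c) ^+ 2) = 0.
    have := hphi _ tphi; rewrite phi'E => hq0.
    transitivity (\int[mu]_(x in I01) (q x * h x - q x * c)).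
      by apply: eq_Rintegral01 => x _; rewrite /q; ring.
    rewrite RintegralB//=; [|exact: integrable01_mul_cont|exact: ic].
    rewrite RintegralZr// Iq mul0r subr0 -[RHS]hq0.
    by apply: eq_Rintegral01 => x _; rewrite mulrC.
  exists c => x dxd.
  have whh : {within `[0, 1], continuous (fun x => w d x * (h x - c) ^+ 2)}.
    move=> y; apply: cvgM; first exact: cwd.
    have hc : {within `[0, 1], continuous (fun x => h x - c)}.
      by move=> z; apply: cvgB; [exact: ch|exact: cvg_cst].
    by apply: cvgM; exact: hc.
  have := Rintegral0_within whh hq.
  move=> /(_ (fun x _ => mulr_ge0 (w_ge0 d x) (sqr_ge0 _)))/(_ x).
  have -> : 0 <= x <= 1 by move/andP: dxd => [? ?]; apply/andP; split; lra.
  move=> /(_ isT)/eqP; rewrite mulf_eq0 sqrf_eq0 subr_eq0 gt_eqF ?w_gt0//=.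
  by move=> /eqP.
have const01 x y : 0 < x < 1 -> 0 < y < 1 -> h x = h y.
  move=> /andP[x0 x1] /andP[y0 y1].
  (* Both points are at distance at least [m] from 0 and 1, so they share the interval []m / 2, 1 -
     m / 2[]. *)
  pose m := Num.min (Num.min x y) (Num.min (1 - x) (1 - y)).
  have m0 : 0 < m by rewrite !lt_min !subr_gt0 x0 y0 x1 y1.
  have [mx my] : m <= x /\ m <= y by rewrite !ge_min !lexx !orbT.
  have [mx1 my1] : m <= 1 - x /\ m <= 1 - y by rewrite !ge_min !lexx !orbT.
  have [||c cP] := loc (m / 2); [by rewrite divr_gt0|lra|].
  by rewrite !cP//; apply/andP; split; lra.
move=> x x01.
have e : forall y, 0 <= y <= 1 -> h y = h (1 / 2).
  apply: ae_eq_within => //.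
    by move=> y; exact: cvg_cst.
  apply: aeW => y; rewrite /= in_itv/= => y01; apply: const01 => //.
  by apply/andP; split; lra.
by rewrite e// [RHS]e// lexx ler01.
Qed.

(** The difference [f - prim f'] is continuous with zero weak derivative, hence constant. *)
Lemma primitive_of_weak_derivative f f' : {within `[0, 1], continuous f} ->
  integrable01 f' -> weak_derivative f f' -> primitive f f'.
Proof.
move=> cf f'i [_ _ ff']; split=> // x x01.
have pf' := primitive_prim 0 f'i.
have cp : {within `[0, 1], continuous (fun x => f x - prim f' x)}.
  by move=> y; apply: cvgB; [exact: cf|exact: prim_within_continuous].
have := @weak_derivative0_const _ cp.
have -> : 0 = 0 :> R by [].
move=> /(_ _ x x01) => h.
apply/eqP; rewrite -subr_eq h ?prim0 ?subr0// => phi tphi.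
have [pphi phi0 phi1] := test_function_primitive tphi.
have [phi'i _] := pphi.
have := primitive_by_parts pf' pphi; rewrite phi0 phi1 !mulr0 subrr => e.
under eq_Rintegral do rewrite mulrBl.
rewrite RintegralB//=; last 2 first.
- exact: integrable01_cont_mul.
- exact: integrable01_cont_mul phi'i (prim_within_continuous _).
rewrite ff'// -opprD -[RHS]oppr0; congr (- _); rewrite -[RHS]e; congr (_ + _).
by apply: eq_Rintegral01 => y _; rewrite add0r.
Qed.

Lemma primitive_of_H1 f f' : H1 f f' -> primitive f f'.
Proof.
move=> [cf _ f'2 ff']; apply: primitive_of_weak_derivative => //.
exact: square_integrable_integrable01.
Qed.

End primitive.

(** * The Wentzell operator *)

Section leb01.
Context {R : realType}.
Notation mu := (@lebesgue_measure R).
Local Notation I01 := (`]0%R, 1%R[%classic : set R).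
Implicit Types (f g : R -> R) (x : R).

Lemma ae_leb01P (P : R -> Prop) :
  {ae leb01 R, forall x, P x} <-> {ae mu, forall x, I01 x -> P x}.
Proof.
split=> -[N [mN N0 PN]].
  exists (N `&` I01); split; first exact: measurableI.
    exact: N0.
  by move=> x /= /not_implyP[xI Px]; split => //; apply: PN.
exists (N `|` ~` I01); split.
- by apply: measurableU => //; exact: measurableC.
- apply/eqP; rewrite eq_le measure_ge0 andbT.
  apply: (@le_trans _ _ (mu N)); last by rewrite N0.
  rewrite /leb01/= /mrestr setIUl setICl setU0.
  by apply: le_measure; rewrite ?inE//; exact: measurableI.
- move=> x /= Px; have [xI|xI] := pselect (I01 x); [left|by right].
  by apply: PN => /=; exact/not_implyP.
Qed.

Lemma integral_leb01 (h : R -> \bar R) : measurable_fun setT h ->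
  (\int[leb01 R]_x h x = \int[mu]_(x in I01) h x)%E.
Proof.
move=> mh; transitivity (\int[leb01 R]_(x in I01) h x)%E.
  rewrite [RHS]integral_mkcond; apply: ae_eq_integral => //.
    by apply/(measurable_restrictT _ _).1 => //; exact: measurable_funTS.
  apply: (ae_leb01P (fun x => setT x -> h x = (h \_ I01) x)).2.
  by apply: aeW => x xI _; rewrite patchE mem_set.
apply: eq_measure_integral => A mA AI.
by rewrite /leb01/= /mrestr setIidl.
Qed.

Lemma L2_dot_leb01 (f g : L2 (leb01 R)) (F G : R -> R) :
  {ae leb01 R, forall x, f x = F x} -> {ae leb01 R, forall x, g x = G x} ->
  measurable_fun I01 F -> measurable_fun I01 G ->
  L2_dot f g = \int[mu]_(x in I01) (F x * G x).
Proof.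
move=> /ae_leb01P fF /ae_leb01P gG mF mG; rewrite /L2_dot /Rintegral.
have mf := L2_measurable f; have mg := L2_measurable g.
have mfg : measurable_fun setT (fun x => (f x * g x)%:E).
  by apply/measurable_EFinP; exact: measurable_funM.
rewrite integral_leb01//; congr fine; apply: ae_eq_integral => //.
- exact: measurable_funTS.
- by apply/measurable_EFinP; exact: measurable_funM.
apply: filterS2 fF gG.
by move=> x fF gG xI; rewrite fF// gG.
Qed.

Lemma L2_leb01_square_integrable (f : L2 (leb01 R)) : square_integrable f.
Proof.
have mf := L2_measurable f; split; first exact: measurable_funTS.
have /integrableP[mff foo] := L2_dot_integrable f f.
apply/integrableP; split; first exact: measurable_funTS.
by rewrite -integral_leb01//; exact: measurableT_comp.
Qed.

Lemma L2_of_square_integrable f : square_integrable f ->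
  exists l : L2 (leb01 R), {ae leb01 R, forall x, l x = f x}.
Proof.
move=> [mf /integrableP[_ foo]].
have mr : measurable_fun setT (f \_ I01) by apply/(measurable_restrictT _ _).1.
have [|l lf] := @L2_of_sqr_lty _ _ _ (leb01 R) (f \_ I01) mr.
  rewrite integral_leb01; last by apply/measurable_EFinP/measurable_funX.
  suff -> : (\int[mu]_(x in I01) ((f \_ I01) x ^+ 2)%:E =
      \int[mu]_(x in I01) `|(f x ^+ 2)%:E|)%E by [].
  by apply: eq_integral => x xI; rewrite patchE xI gee0_abs// lee_fin sqr_ge0.
exists l; apply/ae_leb01P; move/ae_leb01P: lf; apply: filterS.
by move=> x + xI; rewrite patchE mem_set//; exact.
Qed.

End leb01.

(** * Functions in the domain *)

Section wentzell_operator.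
Context {R : realType} {a : R -> R} {x0 : R} (ha : weakly_degenerate a x0).
Notation mu := (@lebesgue_measure R).
Local Notation I01 := (`]0%R, 1%R[%classic : set R).
Implicit Types (u v w z f g : R -> R) (x : R).

Lemma ae_off (P : R -> Prop) : (forall x, 0 < x < 1 -> x != x0 -> P x) ->
  {ae mu, forall x, I01 x -> P x}.
Proof.
move=> Px; exists [set x0]; split => //; first exact: lebesgue_measure_set1.
move=> x /= /not_implyP[]; rewrite in_itv/= => x01 nPx.
by apply/eqP/negPn/negP => xx0; apply: nPx; exact: Px.
Qed.

Lemma integrable01_off f g : (forall x, 0 < x < 1 -> x != x0 -> f x = g x) ->
  measurable_fun I01 f -> integrable01 g -> integrable01 f.
Proof.
move=> fg mf /integrableP[mg goo].
have mf' : measurable_fun I01 (EFin \o f) by exact/measurable_EFinP.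
apply/integrableP; split => //.
suff -> : (\int[mu]_(x in I01) `|(EFin \o f) x| = \int[mu]_(x in I01) `|(EFin \o g) x|)%E.
  by [].
apply: ae_eq_integral => //; try exact: measurableT_comp.
by apply: ae_off => x x01 xx0 /=; rewrite fg.
Qed.

Lemma Rintegral_off f g : (forall x, 0 < x < 1 -> x != x0 -> f x = g x) ->
  measurable_fun I01 f -> measurable_fun I01 g ->
  \int[mu]_(x in I01) f x = \int[mu]_(x in I01) g x.
Proof.
move=> fg mf mg; congr fine; apply: ae_eq_integral => //; try exact/measurable_EFinP.
by apply: ae_off => x x01 xx0; rewrite fg.
Qed.

Lemma integrable01_measurable f : integrable01 f -> measurable_fun I01 f.
Proof. by move=> /integrableP[? _]; exact/measurable_EFinP. Qed.

Lemma weight_gt0 x : 0 < x < 1 -> x != x0 -> 0 < a x.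
Proof. by move=> /andP[x_gt0 x_lt1]; apply: (wd_pos ha); rewrite !ltW. Qed.

(* [|u''| <= a u''^2 + 1 / a] *)
Lemma H2a_primitive u u' u'' : H2a a u u' u'' -> primitive u u' /\ primitive u' u''.
Proof.
move=> [uu' acu' wu' [_ su]]; split; first exact: primitive_of_H1.
have [_ [mu'' _ _] _] := wu'.
apply: primitive_of_weak_derivative => //; first exact: abs_continuous_within.
have iw : integrable01 (fun x => (Num.sqrt (a x) * u'' x) ^+ 2 + (a x)^-1).
  by apply: integrable01D => //; exact: (wd_integrable ha).
have /integrableP[miw iwoo] := iw.
apply/integrableP; split; first exact/measurable_EFinP.
apply: le_lt_trans iwoo; apply: ae_ge0_le_integral => //; try exact: measurableT_comp.
  by apply: measurableT_comp => //; exact/measurable_EFinP.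
apply: ae_off => x x01 xx0 /=; have a0 := weight_gt0 x01 xx0.
rewrite lee_fin exprMn sqr_sqrtr ?(ltW a0)// [`|_ + _|]ger0_norm; last first.
  by rewrite addr_ge0 ?invr_ge0 ?(ltW a0)// mulr_ge0 ?sqr_ge0// ltW.
(* Multiplied by [a x], the bound reads [t <= t^2 + 1] for [t = a x * |u'' x|]. *)
rewrite -(ler_pM2l a0) mulrDr divff ?gt_eqF// -(real_normK (num_real (u'' x))).
by have := sqr_ge0 (a x * `|u'' x| - 1); have := normr_ge0 (u'' x); nra.
Qed.

(** A normal form of [Zmu] together with [u'' 0 = u'' 1 = 0]: two chains of primitives linked by
    [v = a u''], convenient for integrating by parts. *)
Record A1_data u u' u'' v v' v'' : Prop := {
  A1_u : primitive u u' ;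
  A1_u' : primitive u' u'' ;
  A1_v : primitive v v' ;
  A1_v' : primitive v' v'' ;
  A1_v'' : square_integrable v'' ;
  A1_au'' : forall x, 0 <= x <= 1 -> x != x0 -> v x = a x * u'' x ;
  A1_bc : u'' 0 = 0 /\ u'' 1 = 0 }.

Lemma measurable_sqrt_weight : measurable_fun I01 (fun x => Num.sqrt (a x)).
Proof.
apply: measurableT_comp; first by apply: continuous_measurable_fun; exact: sqrt_continuous.
exact: within_measurable01 (wd_continuous ha).
Qed.

Lemma square_integrable_lin c f g : square_integrable f -> square_integrable g ->
  square_integrable (fun x => c * f x + g x).
Proof.
move=> [mf f2] [mg g2].
have mfg : measurable_fun I01 (fun x => c * f x + g x).
  by apply: measurable_funD => //; exact: measurable_funM.
split=> //.
have cst_cont (b : R) : {within `[0, 1], continuous (cst b : R -> R)}.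
  by move=> x; exact: cvg_cst.
have i : integrable01 (fun x => 2 * c ^+ 2 * f x ^+ 2 + 2 * g x ^+ 2).
  apply: integrable01D.
    exact: (integrable01_cont_mul (f := fun x => f x ^+ 2) _ (cst_cont _)).
  exact: (integrable01_cont_mul (f := fun x => g x ^+ 2) _ (cst_cont _)).
apply: le_integrable i => //; first exact/measurable_EFinP/measurable_funX.
move=> x _; rewrite /= lee_fin !ger0_norm ?sqr_ge0//.
  by have := sqr_ge0 (c * f x - g x); nra.
by rewrite addr_ge0// mulr_ge0 ?sqr_ge0// mulr_ge0 ?sqr_ge0.
Qed.

Section data.
Context {u u' u'' v v' v'' : R -> R} (D : A1_data u u' u'' v v' v'').

Lemma A1_cont : [/\ {within `[0, 1], continuous u}, {within `[0, 1], continuous u'},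
  {within `[0, 1], continuous v} & {within `[0, 1], continuous v'}].
Proof. by split; [exact: primitive_cont (A1_u D)|exact: primitive_cont (A1_u' D)|
  exact: primitive_cont (A1_v D)|exact: primitive_cont (A1_v' D)]. Qed.

Lemma A1_int : integrable01 u'' /\ integrable01 v''.
Proof. by case: (A1_u' D) (A1_v' D) => ? _ [? _]. Qed.

Lemma A1_v_bc : v 0 = 0 /\ v 1 = 0.
Proof.
have [x00 x01] : 0 != x0 /\ 1 != x0.
  have /andP[p q] := wd_interior ha.
  by split; [rewrite lt_eqF|rewrite gt_eqF].
have [u0 u1] := A1_bc D.
by split; rewrite (A1_au'' D) ?lexx ?ler01// ?u0 ?u1 mulr0.
Qed.

End data.

(** Off [x0] the square of [sqrt a u''] is [u'' v], an integrable function times a continuous one;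
    the other square integrability conditions come from continuity or from [v'']. *)
Lemma A1_data_Zmu u u' u'' v v' v'' : A1_data u u' u'' v v' v'' ->
  Zmu a x0 u u' u'' v v' v''.
Proof.
move=> D; have [cu cu' cv cv'] := A1_cont D; have [u''i v''i] := A1_int D.
split; last first.
- by split; apply: H1_of_primitive; [exact: A1_v D|exact: within_square_integrable|
    exact: A1_v' D|exact: A1_v'' D].
- exact: A1_au'' D.
split.
- by apply: H1_of_primitive; [exact: A1_u D|exact: within_square_integrable].
- exact: primitive_ac (A1_u' D).
- exact: weak_derivative_of_primitive (A1_u' D).
have msq : measurable_fun I01 (fun x => Num.sqrt (a x) * u'' x).
  by apply: measurable_funM measurable_sqrt_weight (integrable01_measurable _).
split=> //.
have : integrable01 (fun x => (Num.sqrt (a x) * u'' x) ^+ 2); last by [].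
apply: (integrable01_off (g := fun x => u'' x * v x)).
- move=> x x01 xx0; have a0 := weight_gt0 x01 xx0.
  rewrite exprMn sqr_sqrtr ?ltW// (A1_au'' D)//; last by move/andP: x01 => [? ?]; rewrite !ltW.
  by ring.
- exact: measurable_funX.
- exact: integrable01_mul_cont.
Qed.

Lemma Zmu_A1_data u u' u'' v v' v'' : Zmu a x0 u u' u'' v v' v'' ->
  u'' 0 = 0 -> u'' 1 = 0 -> A1_data u u' u'' v v' v''.
Proof.
move=> [/H2a_primitive[uu' uu''] vau [vv' vv'']] u0 u1; split => //.
- exact: primitive_of_H1.
- exact: primitive_of_H1.
- by case: vv''.
Qed.

Lemma A1_data0 : A1_data (cst 0) (cst 0) (cst 0) (cst 0) (cst 0) (cst 0).
Proof.
have c0 : {within `[0, 1], continuous (cst 0 : R -> R)} by move=> x; exact: cvg_cst.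
have i0 := within_integrable01 c0.
have p0 x : prim (cst 0) x = 0 by rewrite /prim Rintegral_cst// mul0r.
have pr : primitive (cst 0 : R -> R) (cst 0) by split=> // x _; rewrite p0 addr0.
split=> //; last by move=> x _ _; rewrite mulr0.
exact: within_square_integrable.
Qed.

Lemma primitive_lin c f f' g g' : primitive f f' -> primitive g g' ->
  primitive (fun x => c * f x + g x) (fun x => c * f' x + g' x).
Proof.
move=> [f'i fE] [g'i gE].
have cf'i : integrable01 (fun x => c * f' x).
  by apply: integrable01_cont_mul => // x; exact: cvg_cst.
split; first exact: integrable01D.
move=> x x01; rewrite fE// gE// /prim; move/andP: x01 => [x_ge0 x_le1].
rewrite RintegralD//=; try exact: (integrable01S (lexx 0) x_le1).
by rewrite RintegralZl//; [ring|exact: (integrable01S (lexx 0) x_le1)].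
Qed.

Lemma A1_data_lin c u u' u'' v v' v'' w w' w'' z z' z'' :
  A1_data u u' u'' v v' v'' -> A1_data w w' w'' z z' z'' ->
  A1_data (fun x => c * u x + w x) (fun x => c * u' x + w' x)
    (fun x => c * u'' x + w'' x) (fun x => c * v x + z x)
    (fun x => c * v' x + z' x) (fun x => c * v'' x + z'' x).
Proof.
move=> D E; split.
- exact: primitive_lin (A1_u D) (A1_u E).
- exact: primitive_lin (A1_u' D) (A1_u' E).
- exact: primitive_lin (A1_v D) (A1_v E).
- exact: primitive_lin (A1_v' D) (A1_v' E).
- exact: square_integrable_lin (A1_v'' D) (A1_v'' E).
- by move=> x x01 xx0; rewrite (A1_au'' D)// (A1_au'' E)//; ring.
- have [-> ->] := A1_bc D; have [-> ->] := A1_bc E.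
  by rewrite mulr0 addr0.
Qed.

(** Zeros propagate down the chain, alternating uniqueness of derivatives with continuity. From
    [u''] to [v] the relation holds only off [x0], and continuity of [v] covers [x0]. This makes
    [A1] single-valued. *)
Lemma A1_data_eq0 u u' u'' v v' v'' : A1_data u u' u'' v v' v'' ->
  {ae mu, forall x, I01 x -> u x = 0} ->
  (forall x, 0 <= x <= 1 -> u x = 0) /\
  (forall x, 0 <= x <= 1 -> v' x = 0) /\
  {ae mu, forall x, I01 x -> v'' x = 0}.
Proof.
move=> D u0ae; have [cu cu' cv cv'] := A1_cont D.
have c0 : {within `[0, 1], continuous (cst 0 : R -> R)}.
  by move=> x; exact: cvg_cst.
have u0 := ae_eq_within cu c0 u0ae.
have u'0 := ae_eq_within cu' c0 (primitive0_ae (A1_u D) u0).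
have u''0 := primitive0_ae (A1_u' D) u'0.
have v0ae : {ae mu, forall x, I01 x -> v x = 0}.
  have vau : {ae mu, forall x, I01 x -> v x = a x * u'' x}.
    apply: ae_off => x /andP[x_gt0 x_lt1].
    by apply: (A1_au'' D); rewrite !ltW.
  apply: filterS2 vau u''0.
  by move=> x vau u''0 xI; rewrite vau// u''0// mulr0.
have v0 := ae_eq_within cv c0 v0ae.
have v'0 := ae_eq_within cv' c0 (primitive0_ae (A1_v D) v0).
by split => //; split => //; exact: primitive0_ae (A1_v' D) v'0.
Qed.

Lemma A1_form u u' u'' v v' v'' w w' w'' z z' z'' :
  A1_data u u' u'' v v' v'' -> A1_data w w' w'' z z' z'' ->
  \int[mu]_(x in I01) (v'' x * w x) + v' 0 * w 0 - v' 1 * w 1 =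
  \int[mu]_(x in I01) (Num.sqrt (a x) * u'' x * (Num.sqrt (a x) * w'' x)).
Proof.
move=> D E; have [_ cu' cv cv'] := A1_cont D; have [u''i _] := A1_int D.
have [w''i _] := A1_int E.
have e1 := primitive_by_parts (A1_v' D) (A1_u E).
have e2 := primitive_by_parts (A1_v D) (A1_u' E).
(* [v] vanishes at both ends, so the second integration by parts has no boundary term. *)
have [v0 v1] := A1_v_bc D; rewrite v0 v1 !mul0r subrr in e2.
have msw f : integrable01 f -> measurable_fun I01 (fun x => Num.sqrt (a x) * f x).
  by move=> fi; exact: measurable_funM measurable_sqrt_weight (integrable01_measurable fi).
rewrite -(@Rintegral_off (fun x => v x * w'' x)
  (fun x => Num.sqrt (a x) * u'' x * (Num.sqrt (a x) * w'' x))); last 3 first.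
- move=> x x01 xx0; have a0 := weight_gt0 x01 xx0.
  rewrite (A1_au'' D)//; last by move/andP: x01 => [? ?]; rewrite !ltW.
  by rewrite -[in LHS](sqr_sqrtr (ltW a0)); ring.
- exact: integrable01_measurable (integrable01_cont_mul w''i cv).
- by apply: measurable_funM; exact: msw.
lra.
Qed.

(** * The graph of the operator in [Xmu] *)

Context {beta0 beta1 : {posnum R}}.
Local Notation X := (Xmu ha beta0 beta1).
Local Notation dot := (Xmu_dot ha beta0 beta1).
Local Notation A1 := (A1 ha beta0 beta1).

(** The boundary conditions solved for the boundary values of [g], with free constants [c0] and [c1]
    because self-adjointness is proved by moving between different values of them. *)
Definition in_A1 (f g : X) u v' v'' (c0 c1 : R) :=
  [/\ {ae leb01 R, forall x, inner f x = u x}, bval0 f = u 0 /\ bval1 f = u 1,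
      {ae leb01 R, forall x, inner g x = v'' x},
      bval0 g = beta0%:num / a 0 * v' 0 - c0 * u 0 &
      bval1 g = - (beta1%:num / a 1 * v' 1) - c1 * u 1].

Lemma A1P c0 c1 (f g : X) : A1 c0 c1 (f, g) <->
  exists u u' u'' v v' v'', A1_data u u' u'' v v' v'' /\ in_A1 f g u v' v'' c0 c1.
Proof.
split.
  move=> [u [u' [u'' [v [v' [v'' [Z [fu f0 f1] gv [u0 u1] [g0 g1]]]]]]]].
  exists u, u', u'', v, v', v''; split; first exact: Zmu_A1_data.
  by split => //; rewrite /= in g0 g1; lra.
move=> [u [u' [u'' [v [v' [v'' [D [fu [f0 f1] gv g0 g1]]]]]]]].
exists u, u', u'', v, v', v''; split => //.
- exact: A1_data_Zmu.
- exact: A1_bc D.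
by rewrite /= g0 g1; split; ring.
Qed.

(** The weights [a j / beta_j] cancel the factors [beta_j / a j] of the boundary conditions, so the
    terms [v' j * w j] join the integral to form the left-hand side of [A1_form]. *)
Lemma A1_dot c0 c1 (f g h k : X) u u' u'' v v' v'' w w' w'' z z' z'' :
  A1_data u u' u'' v v' v'' -> in_A1 f g u v' v'' c0 c1 ->
  A1_data w w' w'' z z' z'' -> in_A1 h k w z' z'' c0 c1 ->
  dot g h = \int[mu]_(x in I01) (Num.sqrt (a x) * u'' x * (Num.sqrt (a x) * w'' x))
    - c0 * (a 0 / beta0%:num) * (u 0 * w 0) - c1 * (a 1 / beta1%:num) * (u 1 * w 1).
Proof.
move=> D [fu [f0 f1] gv g0 g1] E [hw [h0 h1] kz k0 k1].
have [cw _ _ _] := A1_cont E; have [_ v''i] := A1_int D.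
rewrite -(A1_form D E) /Xmu_dot /Defs.dot /= g0 g1 h0 h1.
rewrite (L2_dot_leb01 gv hw); last 2 first.
- exact: integrable01_measurable.
- exact: within_measurable01.
have a0 := lt0r_neq0 (wd_pos0 ha); have a1 := lt0r_neq0 (wd_pos1 ha).
have b0 := lt0r_neq0 (gt0 beta0); have b1 := lt0r_neq0 (gt0 beta1).
by field; rewrite a0 a1 b0 b1.
Qed.

Lemma A1_linear c0 c1 (c : R) (f g h k : X) : A1 c0 c1 (f, g) -> A1 c0 c1 (h, k) ->
  A1 c0 c1 (c *: f + h, c *: g + k).
Proof.
move=> /A1P[u [u' [u'' [v [v' [v'' [D [fu [f0 f1] gv g0 g1]]]]]]]].
move=> /A1P[w [w' [w'' [z [z' [z'' [E [hw [h0 h1] kz k0 k1]]]]]]]].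
apply/A1P; exists (fun x => c * u x + w x), (fun x => c * u' x + w' x),
  (fun x => c * u'' x + w'' x), (fun x => c * v x + z x),
  (fun x => c * v' x + z' x), (fun x => c * v'' x + z'' x).
split; first exact: A1_data_lin.
have lin (p q : L2 (leb01 R)) (P Q : R -> R) :
    {ae leb01 R, forall x, p x = P x} -> {ae leb01 R, forall x, q x = Q x} ->
    {ae leb01 R, forall x, (c *: p + q : L2 (leb01 R)) x = c * P x + Q x}.
  move=> pP qQ; near=> x.
  rewrite (near (L2D_ae (c *: p) q) x)// (near (L2Z_ae c p) x)//.
  by rewrite (near pP x)// (near qQ x).
split.
- exact: lin.
- by rewrite /= f0 f1 h0 h1.
- exact: lin.
- by rewrite /= g0 k0; ring.
- by rewrite /= g1 k1; ring.
Unshelve. all: by end_near. Qed.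

Lemma A1_0 c0 c1 : A1 c0 c1 (0, 0).
Proof.
apply/A1P; exists (cst 0), (cst 0), (cst 0), (cst 0), (cst 0), (cst 0).
split; first exact: A1_data0.
split => //=; [exact: L20_ae|exact: L20_ae|by rewrite !mulr0 subrr|].
by rewrite !mulr0 subr0 oppr0.
Qed.

Lemma A1_fun c0 c1 (f g h : X) : A1 c0 c1 (f, g) -> A1 c0 c1 (f, h) -> g = h.
Proof.
move=> fg fh.
have : A1 c0 c1 (-1 *: f + f, -1 *: h + g) by exact: A1_linear.
rewrite !scaleN1r addNr addrC.
move=> /A1P[u [u' [u'' [v [v' [v'' [D [fu [f0 f1] gv g0 g1]]]]]]]].
have u0ae : {ae mu, forall x, I01 x -> u x = 0}.
  apply/ae_leb01P; near=> x.
  by rewrite -(near fu x)// (near (L20_ae (leb01 R)) x).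
have [u0 [v'0 v''0]] := A1_data_eq0 D u0ae.
have [u00 u01] : u 0 = 0 /\ u 1 = 0 by split; apply: u0; rewrite !lexx ler01.
have [v'00 v'01] : v' 0 = 0 /\ v' 1 = 0 by split; apply: v'0; rewrite !lexx ler01.
apply/subr0_eq/weighted_L2P; last 2 first.
- by rewrite g0 u00 v'00 !mulr0 subrr.
- by rewrite g1 u01 v'01 !mulr0 oppr0 addr0.
apply: L2P; move/ae_leb01P : v''0 => v''0; near=> x.
rewrite (near (L20_ae (leb01 R)) x)// (near gv x)//.
by rewrite (near v''0 x).
Unshelve. all: by end_near. Qed.

Lemma A1_linear_operator c0 c1 : linear_operator (A1 c0 c1).
Proof.
split; first by move=> f g h; exact: A1_fun.
- exact: A1_0.
- by move=> c f g h k; exact: A1_linear.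
Qed.

Lemma A1_nonneg c0 c1 : c0 <= 0 -> c1 <= 0 -> nonneg_operator dot (A1 c0 c1).
Proof.
move=> c00 c10 f g /A1P[u [u' [u'' [v [v' [v'' [D fg]]]]]]].
rewrite (A1_dot D fg D fg).
have wa0 : 0 < a 0 / beta0%:num by rewrite divr_gt0 ?(wd_pos0 ha).
have wa1 : 0 < a 1 / beta1%:num by rewrite divr_gt0 ?(wd_pos1 ha).
rewrite -!expr2 -!mulNr !addr_ge0//.
- by apply: Rintegral_ge0 => x _; rewrite -expr2 sqr_ge0.
- by rewrite mulr_ge0 ?sqr_ge0// mulr_ge0 ?oppr_ge0// ltW.
- by rewrite mulr_ge0 ?sqr_ge0// mulr_ge0 ?oppr_ge0// ltW.
Qed.

Lemma A1_sym c0 c1 (f g h k : X) : A1 c0 c1 (f, g) -> A1 c0 c1 (h, k) ->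
  dot g h = dot f k.
Proof.
move=> /A1P[u [u' [u'' [v [v' [v'' [D fg]]]]]]].
move=> /A1P[w [w' [w'' [z [z' [z'' [E hk]]]]]]].
rewrite (A1_dot D fg E hk) [RHS]dotC -/(dot k f) (A1_dot E hk D fg).
congr (_ - _ - _).
- by apply: eq_Rintegral01 => x _; rewrite mulrC.
- by rewrite (mulrC (u 0)).
- by rewrite (mulrC (u 1)).
Qed.

(** * Solvability, self-adjointness and density *)

Lemma prim_cstD c f : integrable01 f -> prim (fun x => c + f x) 1 = c + prim f 1.
Proof.
move=> fi; have ci : integrable01 (cst c).
  by apply: within_integrable01 => x; exact: cvg_cst.
rewrite /prim RintegralD//= Rintegral_cst//= lebesgue_measure_itv/= lte_fin ltr01.
by rewrite -EFinB subr0 mulr1.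
Qed.

Lemma A1_surj c0 c1 (g : X) : c0 < 0 -> c1 < 0 -> exists f : X, A1 c0 c1 (f, g).
Proof.
move=> c00 c10.
pose v'' := inner g : R -> R.
have v''2 : square_integrable v'' by exact: L2_leb01_square_integrable.
have v''i := square_integrable_integrable01 v''2.
pose V := prim (prim v'').
(* The constant [- V 1] is the slope that brings [v] back to 0 at 1. *)
pose v' x := - V 1 + prim v'' x.
have pv' : primitive v' v'' by exact: primitive_prim.
have v'i : integrable01 v' := within_integrable01 (primitive_cont pv').
pose v x := 0 + prim v' x.
have pv : primitive v v' by exact: primitive_prim.
have v0 : v 0 = 0 by rewrite /v prim0 addr0.
have v1 : v 1 = 0.
  rewrite /v add0r prim_cstD ?addNr//.
  exact/within_integrable01/prim_within_continuous.
pose u'' x := v x / a x.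
have u''i : integrable01 u''.
  have := integrable01_cont_mul (wd_integrable ha) (primitive_cont pv).
  exact.
pose U := prim (prim u'').
(* The boundary conditions solved for [u 0] and [u 1], dividing by the nonzero [c0] and [c1]. *)
pose e0 := (beta0%:num / a 0 * v' 0 - bval0 g) / c0.
pose e1 := (- (beta1%:num / a 1 * v' 1) - bval1 g) / c1.
(* The slope is chosen so that [u] runs from [e0] at 0 to [e1] at 1. *)
pose u' x := (e1 - e0 - U 1) + prim u'' x.
have pu' : primitive u' u'' by exact: primitive_prim.
have u'i : integrable01 u' := within_integrable01 (primitive_cont pu').
pose u x := e0 + prim u' x.
have pu : primitive u u' by exact: primitive_prim.
have u0 : u 0 = e0 by rewrite /u prim0 addr0.
have u1 : u 1 = e1.
  rewrite /u prim_cstD; last exact/within_integrable01/prim_within_continuous.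
  by rewrite -/U subrK subrKC.
have [l lu] := L2_of_square_integrable (within_square_integrable (primitive_cont pu)).
exists (WeightedL2 _ _ l e0 e1); apply/A1P; exists u, u', u'', v, v', v''.
split.
  split=> //.
    move=> x x01 xx0; rewrite /u'' mulrCA divff ?mulr1//.
    by rewrite gt_eqF// (wd_pos ha).
  by rewrite /u'' v0 v1 !mul0r.
split=> //=.
- exact: aeW.
- by rewrite u0 /e0 mulrCA divff ?lt_eqF// mulr1; ring.
- by rewrite u1 /e1 mulrCA divff ?lt_eqF// mulr1; ring.
Qed.

Lemma Xmu_hilbert : hilbert dot.
Proof. exact: wL2_hilbert. Qed.

(* Changing [gamma0], [gamma1] adds a bounded symmetric operator. *)
Definition boundary_scale (c0 c1 : R) (f : X) : X :=
  WeightedL2 _ _ 0 (c0 * bval0 f) (c1 * bval1 f).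

Lemma boundary_scale_sym c0 c1 (f g : X) :
  dot (boundary_scale c0 c1 f) g = dot f (boundary_scale c0 c1 g).
Proof.
rewrite /Xmu_dot /Defs.dot /=.
have -> : L2_dot 0 (inner g) = 0.
  by rewrite -(scale0r (0 : L2 (leb01 R))) L2_dotZl mul0r.
rewrite (L2_dotC (inner f)).
have -> : L2_dot 0 (inner f) = 0.
  by rewrite -(scale0r (0 : L2 (leb01 R))) L2_dotZl mul0r.
ring.
Qed.

Lemma boundary_scaleN c0 c1 (f : X) :
  boundary_scale (- c0) (- c1) f = - boundary_scale c0 c1 f.
Proof. by apply: weighted_L2P; rewrite /= ?oppr0 ?mulNr. Qed.

Lemma A1_shift c0 c1 d0 d1 (f g : X) : A1 c0 c1 (f, g) ->
  A1 d0 d1 (f, g + boundary_scale (c0 - d0) (c1 - d1) f).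
Proof.
move=> /A1P[u [u' [u'' [v [v' [v'' [D [fu [f0 f1] gv g0 g1]]]]]]]].
apply/A1P; exists u, u', u'', v, v', v''; split => //; split => //=.
- by rewrite addr0.
- by rewrite g0 f0; ring.
- by rewrite g1 f1; ring.
Qed.

(* A symmetric operator with full range is self-adjoint; this applies when
   [gamma0, gamma1 < 0], the general case following by [A1_shift]. *)
Lemma A1_selfadjoint c0 c1 : selfadjoint dot (A1 c0 c1).
Proof.
apply/seteqP; split => -[y z]; last first.
  by move=> yz f g fg /=; exact: A1_sym fg yz.
move=> /= yz.
(* [A1 (-1) (-1)] is [A1 c0 c1] plus [B], and it has full range. *)
pose B := boundary_scale (c0 + 1) (c1 + 1).
have N1 : -1 < 0 :> R by rewrite oppr_lt0.
have [f fB] := A1_surj (z + B y) N1 N1.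
have BN h : boundary_scale (-1 - c0) (-1 - c1) h = - B h.
  by rewrite -boundary_scaleN !opprD ![- 1 - _]addrC.
have yf : y = f.
  apply/subr0_eq/(@dot_eq0 _ _ _ _ _ _ (y - f)).
  (* With [h] the preimage of [y - f], both [<y - f, y>] and [<y - f, f>] equal [<h, z + B y>]. *)
  have [h hyf] := A1_surj (y - f) N1 N1.
  have hB := A1_shift c0 c1 hyf; rewrite BN in hB.
  have e1 := yz _ _ hB; have e2 := A1_sym hyf fB.
  rewrite -/(dot (y - f) (y - f)) (ip_subr Xmu_hilbert) e2 (ip_addr Xmu_hilbert).
  rewrite /= (ip_subl Xmu_hilbert) in e1.
  by rewrite -e1 boundary_scale_sym subrK subrr.
have := A1_shift c0 c1 fB; rewrite BN -yf.
by rewrite addrK.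
Qed.

Lemma A1_dense c0 c1 (x : X) e : 0 < e -> exists2 d, dom (A1 c0 c1) d & `|x - d| <= e.
Proof.
apply: (dense_of_trivial_orthogonal Xmu_hilbert).
- by exists 0; exact: A1_0.
- by move=> c f h [g fg] [k hk]; exists (c *: g + k); exact: A1_linear.
move=> y yW; apply: (@A1_fun c0 c1 0); last exact: A1_0.
rewrite -A1_selfadjoint => f g fg /=.
by rewrite (ip_0r Xmu_hilbert) yW//; exists g.
Qed.

End wentzell_operator.

Theorem theorem3p1 (R : realType) (a : R -> R) (x0 : R)
  (ha : weakly_degenerate a x0) (beta0 beta1 : {posnum R})
  (gamma0 gamma1 : R) (hgamma0 : gamma0 <= 0) (hgamma1 : gamma1 <= 0) :
  let A := A1 ha beta0 beta1 gamma0 gamma1 in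
  let dot := Xmu_dot ha beta0 beta1 in
  [/\ linear_operator A,
      nonneg_operator dot A,
      selfadjoint dot A,
      dense (dom A) &
      generates_contraction_semigroup (opp_operator A)].
Proof.
move=> A dot.
have Alin : linear_operator A by exact: A1_linear_operator.
have Anneg : nonneg_operator dot A by exact: A1_nonneg.
have Asa : selfadjoint dot A by exact: A1_selfadjoint.
have Adense x e : 0 < e -> exists2 d, dom A d & `|x - d| <= e by exact: A1_dense.
split => //; last first.
  have Hdot := Xmu_hilbert (beta0 := beta0) (beta1 := beta1) ha.
  exact: (selfadjoint_generates Hdot Alin Anneg Asa Adense).
move=> O [x Ox] oO.
have /nbhs_ballP[e /= e0 eO] : nbhs x O by exact: open_nbhs_nbhs.
have e20 : 0 < e / 2 by rewrite divr_gt0.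
have [d dA xd] := Adense x _ e20.
exists d; split => //; apply: eO; rewrite -ball_normE /=.
by rewrite (le_lt_trans xd)// ltr_pdivrMr// ltr_pMr// ltr1n.
Qed.
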